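(* Let $f:S^1\to S^1$ be a multicritical circle map without periodic points and let $c_0$ be one of its critical points. There exists a constant $K>1$, depending only on $f$, such that the following holds for every $n\ge 0$. Let $0\le k<a_{n+1}$ be such that the interval $f^{q_n+kq_{n+1}}(I_{n+1}(c_0))\subset I_n(c_0)$ contains a critical point of $f^{q_{n+1}}$. Then $$K^{-1}|I_n(c_0)|\le\left|f^{q_n+kq_{n+1}}(I_{n+1}(c_0))\right|\le K|I_n(c_0)|.$$
   Context: $S^1=\mathbb{R}/\mathbb{Z}$; $|I|$ is the length of an interval $I\subset S^1$. A multicritical circle map is an orientation-preserving homeomorphism $f:S^1\to S^1$ of class $C^r$, $r\ge 3$, having finitely many critical points $c_0,\dots,c_{N-1}$, $N\ge 1$, such that there exist (open) neighbourhoods $W_i\subseteq S^1$ of $c_i$ ($0\le i\le N-1$) with: (1) $f$ has negative Schwarzian derivative on $W_i\setminus\{c_i\}$; (2) there exist constants $0<\alpha_i<\beta_i$ and $s_i>1$ such that $\alpha_i|x-c_i|^{s_i-1}<f'(x)<\beta_i|x-c_i|^{s_i-1}$ for all $x\in W_i\setminus\{c_i\}$; (3) the variation of $\log f'$ on $S^1\setminus\bigcup_i W_i$ is finite. Since $f$ has no periodic points, its rotation number $\rho\in(0,1)$ is irrational; write $\rho=[a_0,a_1,\dots]=\cfrac{1}{a_0+\cfrac{1}{a_1+\cdots}}$ and $q_0=1$, $q_1=a_0$, $q_{n+1}=a_nq_n+q_{n-1}$ for $n\ge1$. For $x\in S^1$, $I_n(x)$ is the closed interval with endpoints $x$ and $f^{q_n}(x)$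 that contains $f^{q_{n+2}}(x)$. *)

(* Defs.v *)
From HB Require Import structures.
From mathcomp Require Import all_boot all_order all_algebra.
From mathcomp Require Import generic_quotient ring_quotient.
From mathcomp Require Import all_classical all_reals all_analysis.

Set Implicit Arguments.
Unset Strict Implicit.
Unset Printing Implicit Defensive.

Import Order.TTheory GRing.Theory Num.Theory.
Import numFieldNormedType.Exports.

Local Open Scope classical_set_scope.
Local Open Scope quotient_scope.
Local Open Scope ring_scope.

Definition fracpart (R : realType) (x : R) : R := x - (Num.floor x)%:~R.

Definition integers (R : realType) : zmodClosed R :=
  GRing.ZmodClosed.clone R (@Num.int_num_subdef R) _.

(* S^1 = R/Z, the quotient of the additive group R by its integers, with the
   quotient topology (the quotient only requires an additive subgroup, not an
   ideal). *)
Definition circle (R : realType) : Type :=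
  quotient_topology (Quotient.quot (integers R)).

Definition circle_pi (R : realType) : R -> circle R := \pi_(circle R).

Section CircleGeometry.
Context {R : realType}.
Implicit Types (u v z : circle R) (A : set (circle R)).

(* Length of the positively oriented arc from u to v; a value in [0, 1[ that
   does not depend on the representatives. *)
Definition ccw u v : R := fracpart (repr v - repr u).

(* The closed arc covered when moving from u to v in the positive direction. *)
Definition ccw_arc u v : set (circle R) := [set z | ccw u z <= ccw u v].

Definition cdist u v : R := Num.min (ccw u v) (ccw v u).

(* |A|, the Lebesgue measure of A through the fundamental domain [0, 1[. *)
Definition clength A : \bar R :=
  lebesgue_measure (`[0, 1[%classic `&` @circle_pi R @^-1` A).

(* phi has finite total variation on A: the sums of |phi x_{i+1} - phi x_i| over
   the finite sequences x_0 < ... < x_n of points of A making at most one turn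
   are bounded. *)
Definition finite_variation_on A (phi : circle R -> R) : Prop :=
  exists M : R, forall (a b : R) (s : seq R),
    itv_partition a b s -> b <= a + 1 ->
    (forall x, x \in a :: s -> A (circle_pi x)) ->
    variation a b (phi \o @circle_pi R) s <= M.

End CircleGeometry.

Section CircleMaps.
Context {R : realType}.
Implicit Types (f : circle R -> circle R) (F : R -> R) (z : circle R).

Definition circle_homeo f : Prop :=
  continuous f /\
  exists2 g : circle R -> circle R, continuous g & cancel f g /\ cancel g f.

Definition is_lift f F : Prop :=
  continuous F /\ forall x, circle_pi (F x) = f (circle_pi x).

(* A chosen lift; any two lifts differ by an integer constant. *)
Definition lift_of f : R -> R := get [set F | is_lift f F].

Definition orientation_preserving f : Prop :=
  exists2 F, is_lift f F & {homo F : x y / x < y}.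

Definition class_Cr (r : nat) f : Prop :=
  exists2 F, is_lift f F &
    (forall k, (k < r)%N -> forall x, derivable (derive1n k F) x 1) /\
    continuous (derive1n r F).

(* The k-th derivative of f (k >= 1) as a function on the circle. *)
Definition cderiv (k : nat) f z : R := derive1n k (lift_of f) (repr z).

Definition critical_point f z : Prop := cderiv 1 f z = 0.

Definition schwarzian f z : R :=
  cderiv 3 f z / cderiv 1 f z
  - 3 / 2 * (cderiv 2 f z / cderiv 1 f z) ^+ 2.

Definition multicritical (r : nat) f : Prop :=
  [/\ circle_homeo f, orientation_preserving f, class_Cr r f &
    exists (N : nat) (c : 'I_N -> circle R) (W : 'I_N -> set (circle R)),
    [/\ [/\ (0 < N)%N, injective c,
            forall z, critical_point f z <-> exists i, z = c i &
            forall i, open (W i) /\ W i (c i)],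
        forall i z, W i z -> z <> c i -> schwarzian f z < 0,
        forall i, exists alpha beta s : R,
          [/\ 0 < alpha, alpha < beta, 1 < s &
            forall z, W i z -> z <> c i ->
              alpha * cdist z (c i) `^ (s - 1) < cderiv 1 f z /\
              cderiv 1 f z < beta * cdist z (c i) `^ (s - 1)] &
        finite_variation_on (~` \bigcup_i W i) (fun z => ln (cderiv 1 f z))]].

Definition no_periodic_points f : Prop :=
  forall z (n : nat), (0 < n)%N -> iter n f z <> z.

(* The representative in [0, 1[ of the rotation number, which is defined
   modulo 1 as the mean translation lim F^n(0)/n of a lift F. *)
Definition rotation_number f : R :=
  fracpart (lim ((fun n : nat => iter n (lift_of f) 0 / n%:R) @ \oo)).

End CircleMaps.

Section ContinuedFraction.
Context {R : realType}.
Implicit Types rho : R.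

(* Partial quotients of rho = 1/(a_0 + 1/(a_1 + ...)), rho in ]0, 1[ irrational,
   through the Gauss map x |-> {1/x}. *)
Definition cf_coef rho (n : nat) : nat :=
  Num.truncn (iter n (fun x => fracpart x^-1) rho)^-1.

Fixpoint cf_denom rho (n : nat) : nat :=
  match n with
  | 0 => 1
  | n1.+1 => match n1 with
             | 0 => cf_coef rho 0
             | n2.+1 => cf_coef rho n1 * cf_denom rho n1 + cf_denom rho n2
             end
  end%N.

End ContinuedFraction.

Section DynamicalIntervals.
Context {R : realType}.
Variable f : circle R -> circle R.

Definition pquot (n : nat) : nat := cf_coef (rotation_number f) n.
Definition qden (n : nat) : nat := cf_denom (rotation_number f) n.

(* I_n(x): of the two closed arcs with endpoints x and f^{q_n}(x), the one that
   contains f^{q_{n+2}}(x). *)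
Definition Iint (n : nat) (x : circle R) : set (circle R) :=
  let y := iter (qden n) f x in
  if iter (qden n.+2) f x \in ccw_arc x y then ccw_arc x y else ccw_arc y x.

End DynamicalIntervals.

(* Main.v *)
(* Let F be a lift of f, G = F^{q_n} - p_n and H = F^{q_{n+1}} - p_{n+1}: they
   move points in opposite directions, H less far than G, and F^d + b with
   0 < d < q_{n+1} moves every point at least as far as G.

   Cross-ratio inequality: one application of F increases a cross-ratio
   |L||R| / (|L u M||M u R|) at most by a bounded factor when the interval meets
   the critical set, and by a factor 1 + O(|T|) when T = L u M u R is disjoint
   from it (near a critical point the negative Schwarzian derivative even makes
   cross-ratios decrease).  The images F^i(T), i < q_{n+1}, of an interval T inside
   three steps of G cover each point a bounded number of times, so
   F^m, m <= q_{n+1}, increases the cross-ratios of such intervals at most by a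
   constant C that does not depend on n.  In other words, F^m can be used to pull
   back definite space around the middle interval M.

   Comparable steps: where the step [z, Gz] is shortest, the two steps before it
   are bounded multiples of it; any orbit visits that place before time q_{n+1},
   and pulling back shows that adjacent steps of G are comparable everywhere.

   Critical points: for c critical of order s, the ratio e of |[Hc, c]| to
   |[c, Gc]| becomes O(e^s) under F, whereas F^{q_{n+1}-1} then brings it back to
   order e; the cross-ratio inequality gives e <= O(e^s), so e is bounded below.

   Conclusion: the interval of the statement is [Hu, u] with u = H^k G x between x
   and Gx, and F^j([Hu, u]) contains a critical point of f for some j < q_{n+1}.  At
   that point the step of H is comparable with the step of G, and pulling back by
   F^j shows that [Hu, u] is comparable with [u, Gu], hence with [x, Gx].

   Everything is done for G moving to the right; the other parity of n follows by
   conjugating F with x |-> - x. *)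

Require Import Defs.
From mathcomp Require Import all_boot all_order all_algebra.
From mathcomp Require Import generic_quotient ring_quotient.
From mathcomp Require Import all_classical all_reals all_analysis.
From mathcomp Require Import zify ring lra.

Set Implicit Arguments.
Unset Strict Implicit.
Unset Printing Implicit Defensive.

Import Order.TTheory GRing.Theory Num.Theory.
Import numFieldNormedType.Exports.

Local Open Scope classical_set_scope.
Local Open Scope quotient_scope.
Local Open Scope ring_scope.

(** * Lifts of circle homeomorphisms *)

(** With [L = [a, b]], [M = [b, c]], [R = [c, d]] this is [|L||R| / (|L u M||M u R|)]; it is small
    when [M] is long compared with [L] or with [R]. *)
Definition cratio (R : realType) (a b c d : R) : R :=
  ((b - a) * (d - c)) / ((c - a) * (d - b)).

Lemma cratio_gt0 (R : realType) (a b c d : R) :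
  a < b -> b < c -> c < d -> 0 < cratio a b c d.
Proof.
move=> ab bc cd; rewrite /cratio divr_gt0 // mulr_gt0 // subr_gt0 //.
  exact: lt_trans bc.
exact: lt_trans cd.
Qed.

(** Induction on the number of intervals: the one with the largest left endpoint is removed, and all
    the others end before it begins. *)
Lemma disjoint_length_le (R : realType) (I : finType) (S : {set I}) (x y : I -> R)
    (a b : R) :
  a <= b -> (forall i, i \in S -> [/\ a <= x i, x i < y i & y i <= b]) ->
  (forall i j, i \in S -> j \in S -> i != j -> y i <= x j \/ y j <= x i) ->
  \sum_(i in S) (y i - x i) <= b - a.
Proof.
move: {2}#|S| (erefl #|S|) b => n; elim: n S => [|n IH] S cS b ab hxy hS.
  by rewrite (cards0_eq cS) big_set0 subr_ge0.
have /card_gt0P[i0 i0S] : (0 < #|S|)%N by rewrite cS.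
have [i iS imax] : exists2 i, i \in S & forall j, j \in S -> x j <= x i.
  by case: (arg_maxP x i0S) => i iS im; exists i.
have [axi xyi yib] := hxy i iS.
rewrite (big_setD1 i) //=.
have : \sum_(j in S :\ i) (y j - x j) <= x i - a.
  apply: IH => //.
  - by have := cardsD1 i S; rewrite iS cS add1n => -[].
  - move=> j; rewrite !inE => /andP[ji jS]; have [? ? ?] := hxy j jS.
    split=> //; case: (hS j i jS iS ji) => // yx.
    by have := lt_le_trans xyi yx; rewrite ltNge imax.
  - by move=> j k; rewrite !inE => /andP[_ jS] /andP[_ kS]; exact: hS.
by lra.
Qed.

Section PeriodicFunctions.
Context (R : realType).
Implicit Types (f : R -> R) (x : R) (k : int).

Lemma periodic_intr f : (forall x, f (x + 1) = f x) ->
  forall x k, f (x + k%:~R) = f x.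
Proof.
move=> per x k.
have perN (n : nat) z : f (z + n%:R) = f z.
  by elim: n => [|n IH]; rewrite ?addr0 // -natr1 addrA per IH.
case: (intP k) => [|n|n]; first by rewrite addr0.
  by rewrite perN.
by rewrite -(perN n.+1) rmorphN /= subrK.
Qed.

Lemma periodic_min f : (forall x, f (x + 1) = f x) -> continuous f ->
  exists z, forall x, f z <= f x.
Proof.
move=> per cf.
have [z _ zmin] := @EVT_min R f 0 1 ler01 (continuous_subspaceT cf).
exists z => x; have /andP[h1 h2] := floor_itv x; rewrite rmorphD /= in h2.
have xin : x + (- Num.floor x)%:~R \in `[0, 1]%R by rewrite in_itv /= rmorphN /=; lra.
by have := zmin _ xin; rewrite (periodic_intr per).
Qed.

Lemma periodic_bounded f : (forall x, f (x + 1) = f x) -> continuous f ->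
  exists2 M, 0 < M & forall x, `|f x| <= M.
Proof.
move=> per cf.
have [|x|z zmin] := @periodic_min (fun x => - `|f x|).
- by move=> x; rewrite per.
- by apply: cvgN; apply: cvg_norm; exact: cf.
exists (1 + `|f z|); first by rewrite ltr_pwDl.
by move=> x; have := zmin x; lra.
Qed.

Lemma degree_one_addz f : (forall x, f (x + 1) = f x + 1) ->
  forall x k, f (x + k%:~R) = f x + k%:~R.
Proof.
move=> per x k; have per' y : f (y + 1) - (y + 1) = f y - y by rewrite per; ring.
by have := periodic_intr per' x k; lra.
Qed.

Lemma iter_addz f : (forall x k, f (x + k%:~R) = f x + k%:~R) ->
  forall (a : nat) x k, iter a f (x + k%:~R) = iter a f x + k%:~R.
Proof. by move=> fk a x k; elim: a => //= a ->. Qed.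

Lemma iter_le_mono f (a : nat) :
  {mono f : x y / x <= y} -> {mono iter a f : x y / x <= y}.
Proof. by move=> mf; elim: a => // a IH x y /=; rewrite mf IH. Qed.

Lemma iter_continuous f (a : nat) : continuous f -> continuous (iter a f).
Proof.
move=> cf; elim: a => [|a IH] x; first exact: cvg_id.
rewrite (_ : iter a.+1 f = f \o iter a f); last by apply/funext.
by apply: continuous_comp; [exact: IH | exact: cf].
Qed.

End PeriodicFunctions.

Section RotationLift.
Context (R : realType).
Implicit Types (F : R -> R) (rho x y : R) (a b : nat) (k l p P : int).

Definition shifted_iter F a k x : R := iter a F x + k%:~R.

(** The last clause characterizes [rho] by order: at every point the displacement of [F^a + k] has
    the sign of [a rho + k]. Questions about the order of orbits thus become inequalities between
    real numbers. *)
Definition lift_with_rotation F rho : Prop :=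
  [/\ {mono F : x y / x <= y}, forall x, F (x + 1) = F x + 1,
      continuous F, forall y, exists x, F x = y &
      forall a k x,
        (x < shifted_iter F a k x) = (0 < a%:R * rho + k%:~R) /\
        (shifted_iter F a k x < x) = (a%:R * rho + k%:~R < 0)].

(* [p] and [P] are added: the convergents are [- p / q] and [- P / Q]. *)
Definition consecutive_returns rho (q : nat) (p : int) (Q : nat) (P : int) : Prop :=
  let t := q%:R * rho + p%:~R in let t' := Q%:R * rho + P%:~R in
  [/\ (0 < q <= Q)%N, 0 < t < 1, t' < 0, 0 < t + t' &
      forall a k, (0 < a < Q)%N -> t <= `|a%:R * rho + k%:~R|].

Context (F : R -> R) (rho : R) (hF : lift_with_rotation F rho).
Local Notation mv := (shifted_iter F).

Lemma lift_addz x k : F (x + k%:~R) = F x + k%:~R.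
Proof. by have [_ per _ _ _] := hF; exact: degree_one_addz. Qed.

Lemma iter_lift_addz (a : nat) x k : iter a F (x + k%:~R) = iter a F x + k%:~R.
Proof. exact: iter_addz lift_addz _ _ _. Qed.

Lemma shifted_iterD a k b l x : mv a k (mv b l x) = mv (a + b) (k + l) x.
Proof. by rewrite /mv iter_lift_addz iterD rmorphD /= -addrA (addrC l%:~R). Qed.

Lemma iter_lift_mono a : {mono iter a F : x y / x <= y}.
Proof. by have [mF _ _ _ _] := hF; exact: iter_le_mono. Qed.

Lemma iter_lift_mono_lt a : {mono iter a F : x y / x < y}.
Proof. exact: leW_mono (iter_lift_mono a). Qed.

Lemma shifted_iter_mono a k : {mono mv a k : x y / x <= y}.
Proof. by move=> x y; rewrite /mv lerD2r iter_lift_mono. Qed.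

Lemma iter_lift_surj a y : exists x, iter a F x = y.
Proof.
elim: a y => [|a IH] y; first by exists y.
by case: hF => _ _ _ /(_ y)[z <-] _; have [x <-] := IH z; exists x.
Qed.

Lemma shifted_iter_surj a k y : exists x, mv a k x = y.
Proof.
by have [x hx] := iter_lift_surj a (y - k%:~R); exists x; rewrite /mv hx subrK.
Qed.

Lemma shifted_iter_continuous a k : continuous (mv a k).
Proof.
have [_ _ cF _ _] := hF => x.
by apply: cvgD; [exact: iter_continuous | exact: cvg_cst].
Qed.

(** The map with fewer iterates is applied first, so that the comparison becomes the sign of one
    displacement at its image point. *)
Lemma shifted_iter_lt a k b l x :
  (mv a k x < mv b l x) = (a%:R * rho + k%:~R < b%:R * rho + l%:~R).
Proof.
case: hF => _ _ _ _ ord; have [ab|/ltnW ba] := leqP a b.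
  rewrite -(subnKC ab) addnC -[l](subrK k) -shifted_iterD natrD rmorphD /=.
  rewrite (ord (b - a)%N (l - k) (mv a k x)).1 -[RHS]subr_gt0.
  by congr (_ < _); ring.
rewrite -(subnKC ba) addnC -[k](subrK l) -shifted_iterD natrD rmorphD /=.
rewrite (ord (a - b)%N (k - l) (mv b l x)).2 -[RHS]subr_lt0.
by congr (_ < _); ring.
Qed.

Lemma shifted_iter_le a k b l x :
  (mv a k x <= mv b l x) = (a%:R * rho + k%:~R <= b%:R * rho + l%:~R).
Proof. by rewrite leNgt shifted_iter_lt -leNgt. Qed.

End RotationLift.

(** * The cross-ratio inequality *)

Section CrossRatioInequality.
Context (R : realType).
Implicit Types (F : R -> R) (rho x y : R) (k l p P : int).

(** [cs] represents the critical points modulo [1]. The factors are exponentials so that along an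
    orbit the exponents add up to a total length plus a number of hits. *)
Definition cratio_distortion F (cs : seq R) (A : R) : Prop :=
  [/\ 0 <= A,
      forall a b c d, a < b -> b < c -> c < d ->
        cratio (F a) (F b) (F c) (F d) <= expR A * cratio a b c d &
      forall a b c d, a < b -> b < c -> c < d ->
        (forall e k, e \in cs -> ~~ (a <= e + k%:~R <= d)) ->
        cratio (F a) (F b) (F c) (F d) <= expR (A * (d - a)) * cratio a b c d].

Context (F : R -> R) (rho : R) (hF : lift_with_rotation F rho).
Context (cs : seq R) (A : R) (hA : cratio_distortion F cs A).
Context (q : nat) (p : int) (Q : nat) (P : int).
Context (hq : consecutive_returns rho q p Q P).
Local Notation mv := (shifted_iter F).
Local Notation G := (shifted_iter F q p).

Lemma shifted_iter00 x : mv 0 0 x = x.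
Proof. by rewrite /mv /= addr0. Qed.

Let Glt x : x < G x.
Proof.
case: hq => _ /andP[t0 _] _ _ _.
by rewrite -{1}[x]shifted_iter00 (shifted_iter_lt hF) mul0r add0r.
Qed.

Let Gmono : {mono G : x y / x <= y}.
Proof. exact: (shifted_iter_mono hF). Qed.

(** The best-approximation clause of [consecutive_returns], read on orbits: before time [Q] an orbit
    never comes back, modulo integers, to within less than one step of [G]. *)
Lemma return_gap a k y : (0 < a < Q)%N -> G y <= mv a k y \/ G (mv a k y) <= y.
Proof.
case: hq => _ _ _ _ best aQ; have h := best a k aQ.
rewrite (shifted_iterD hF) -{4}[y]shifted_iter00 !(shifted_iter_le hF) natrD rmorphD /=.
have [|] := leP 0 (a%:R * rho + k%:~R) => s.
  by left; rewrite ger0_norm in h.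
by right; rewrite ltr0_norm // in h; rewrite mulr0n mul0r; lra.
Qed.

(** Translated by the integer part of its left endpoint, each [[F^i y, F^i (G y)]] lies in [[0, 2]];
    by [return_gap] the translates have disjoint interiors. *)
Lemma sum_iter_return_le y (m : nat) :
  (m <= Q)%N -> \sum_(i < m) (iter i F (G y) - iter i F y) <= 2.
Proof.
move=> mQ; set z := fun i : 'I_m => (Num.floor (iter i F y))%:~R : R.
have -> : \sum_(i < m) (iter i F (G y) - iter i F y) =
    \sum_(i in [set: 'I_m]%SET) ((iter i F (G y) - z i) - (iter i F y - z i)).
  rewrite [RHS](eq_bigl predT) => [|i]; last by rewrite inE.
  by apply: eq_bigr => i _; ring.
rewrite -[leRHS]subr0; apply: disjoint_length_le => // [i _|i j _ _].
  have := floor_itv (iter i F y) => /andP[h1 h2].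
  rewrite rmorphD /= in h2.
  have : iter i F y < iter i F (G y) by rewrite (iter_lift_mono_lt hF).
  have : iter i F (G y) <= iter i F y + 1%:~R.
    rewrite -(iter_lift_addz hF) (iter_lift_mono hF).
    have -> : y + 1%:~R = mv 0 1 y by [].
    rewrite (shifted_iter_le hF) mul0r add0r.
    by case: hq => _ /andP[_ /ltW].
  by rewrite /z => ? ?; split; rewrite ?subr_ge0 //; lra.
have main (i' j' : 'I_m) : (i' < j')%N ->
    iter i' F (G y) - z i' <= iter j' F y - z j' \/
    iter j' F (G y) - z j' <= iter i' F y - z i'.
  move=> ij; pose k := Num.floor (iter i' F y) - Num.floor (iter j' F y).
  have dQ : (0 < j' - i' < Q)%N.
    by rewrite subn_gt0 ij /= (leq_ltn_trans (leq_subr _ _)) // (leq_trans _ mQ).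
  have kE : k%:~R = z i' - z j' by rewrite rmorphB.
  have iE u : iter i' F (mv (j' - i')%N k u) = iter j' F u + (z i' - z j').
    by rewrite /mv (iter_lift_addz hF) kE -iterD subnKC // ltnW.
  case: (return_gap k y dQ) => h; [left|right].
    by move: h; rewrite -(iter_lift_mono hF i') iE; lra.
  move: h; rewrite (shifted_iterD hF) addnC addrC -(shifted_iterD hF).
  by rewrite -(iter_lift_mono hF i') iE; lra.
by move=> ij; have [/main|/main[]|/val_inj ji] := ltngtP i j;
  [|right|left|rewrite ji eqxx in ij].
Qed.

(** The number of steps of [G] from [v] that fit below [x], capped at [3]. Points of
    [[v, G (G (G v))]] a full step apart get different levels. *)
Let level v x := ((G v <= x)%R + (G (G v) <= x)%R + (G (G (G v)) <= x)%R)%N.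

Let level_lt v x y : v <= x -> y <= G (G (G v)) -> G x <= y ->
  (level v x < level v y)%N.
Proof.
move=> vx yv xy; rewrite /level.
have up w : w <= x -> G w <= y by move=> wx; rewrite (le_trans _ xy) // Gmono.
rewrite (up _ vx).
have /negbTE -> : ~~ (G (G (G v)) <= x).
  by rewrite -ltNge (lt_le_trans (Glt x)) // (le_trans xy).
have [/up -> |h1] := boolP (G v <= x).
  have [/up -> |_] := boolP (G (G v) <= x) => //.
have /negbTE -> : ~~ (G (G v) <= x).
  by apply: contra h1; apply: le_trans; rewrite ltW.
by case: (_ <= y).
Qed.

Lemma card_iter_hits_le (c v : R) (m : nat) : (m <= Q)%N ->
  (#|[set i : 'I_m | `[< exists k,
      (iter i F v <= c + k%:~R <= iter i F (G (G (G v))))%R >]]%SET| <= 4)%N.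
Proof.
move=> mQ; set S := finset _.
have /choice[x xP] : forall i : 'I_m, exists x, i \in S ->
    v <= x <= G (G (G v)) /\ exists k, iter i F x = c + k%:~R.
  move=> i; have [|] := boolP (i \in S); last by exists 0.
  rewrite inE => /asboolP[k hk]; have [x hx] := iter_lift_surj hF i (c + k%:~R).
  by exists x => _; split; [move: hk; rewrite -hx !(iter_lift_mono hF) | exists k].
(* The points [x i] are a full step of [G] apart, hence on distinct levels. *)
have lt4 i : (level v (x i) < 4)%N by rewrite /level; do !case: (_ <= _).
have <- := card_ord 4.
rewrite -(@card_in_imset _ _ (fun i => Ordinal (lt4 i))) ?max_card //.
have main (i j : 'I_m) : i \in S -> j \in S -> (i < j)%N ->
    level v (x i) <> level v (x j).
  move=> iS jS ij; have [/andP[vi iv] [k hk]] := xP i iS.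
  have [/andP[vj jv] [l hl]] := xP j jS.
  (* Both hits are translates of the same [c] and [F^i] is injective, so [x i] is, up to an integer,
     the iterate of order [j - i < Q] of [x j], and [return_gap] applies. *)
  have xE : x i = mv (j - i)%N (k - l) (x j).
    apply: (inc_inj (iter_lift_mono hF i)).
    rewrite /mv (iter_lift_addz hF) -iterD subnKC ?(ltnW ij) // hk hl rmorphB /=.
    by ring.
  have dQ : (0 < j - i < Q)%N.
    by rewrite subn_gt0 ij /= (leq_ltn_trans (leq_subr _ _)) // (leq_trans _ mQ).
  case: (return_gap (k - l) (x j) dQ); rewrite -xE => g e.
    by have := level_lt vj iv g; rewrite e ltnn.
  by have := level_lt vi jv g; rewrite e ltnn.
move=> i j iS jS [] e; case: (ltngtP i j) => [ij|ji|/val_inj //].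
  by case: (main i j iS jS ij).
by case: (main j i jS iS ji).
Qed.

(** One iterate costs [expR (A * len i)] without a hit and at most [expR A] with one. The lengths
    add up to at most [6], three steps of [G] with [2] each, and every point of [cs] accounts for at
    most [4] hits. *)
Lemma cratio_iter_le v a b c d (m : nat) : (m <= Q)%N ->
  v <= a -> a < b -> b < c -> c < d -> d <= G (G (G v)) ->
  cratio (iter m F a) (iter m F b) (iter m F c) (iter m F d) <=
  expR (A * (6 + (4 * size cs)%:R)) * cratio a b c d.
Proof.
move=> mQ va ab bc cd dv; have [A0 hA1 hA2] := hA.
have hlt := iter_lift_mono_lt hF; have hle := iter_lift_mono hF.
pose len i := iter i F (G (G (G v))) - iter i F v.
pose hit e i : nat := `[< exists k, iter i F v <= e + k%:~R <= iter i F (G (G (G v))) >].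
have cr_gt0 i : 0 < cratio (iter i F a) (iter i F b) (iter i F c) (iter i F d).
  by rewrite cratio_gt0 // hlt.
apply: (@le_trans _ _ (expR (A * \sum_(i < m) (len i + (\sum_(e <- cs) hit e i)%:R))
    * cratio a b c d)).
  elim: m {mQ} => [|m IH]; first by rewrite big_ord0 mulr0 expR0 mul1r.
  rewrite big_ord_recr /= mulrDr expRD mulrAC.
  rewrite (le_trans _ (ler_wpM2r (expR_ge0 _) IH)) // mulrC.
  have [hit0|hit_gt0] := eqVneq (\sum_(e <- cs) hit e m)%N 0%N.
    rewrite (le_trans (hA2 _ _ _ _ _ _ _ _)) ?hlt // => [e k ecs|].
      move/eqP: hit0; rewrite sum_nat_seq_eq0 => /allP/(_ e ecs) /=.
      rewrite /hit eqb0 => /asboolPn h.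
      apply/negP => /andP[h1 h2]; apply: h; exists k.
      by rewrite (le_trans _ h1) ?(le_trans h2) // hle.
    rewrite hit0 addr0 ler_wpM2r ?(ltW (cr_gt0 m)) // ler_expR ler_wpM2l //.
    by rewrite /len lerB // hle.
  rewrite (le_trans (hA1 _ _ _ _ _ _ _)) ?hlt //.
  rewrite ler_wpM2r ?(ltW (cr_gt0 m)) // ler_expR -{1}[A]mulr1 ler_wpM2l //.
  have : (1 <= (\sum_(e <- cs) hit e m)%:R :> R) by rewrite ler1n lt0n.
  have : 0 <= len m by rewrite subr_ge0 hle !ltW // (lt_trans (Glt _)) // (lt_trans (Glt _)).
  by lra.
rewrite ler_wpM2r ?(ltW (cr_gt0 0)) // ler_expR ler_wpM2l // big_split /=.
apply: lerD.
  have -> : \sum_(i < m) len i =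
      \sum_(i < m) (iter i F (G v) - iter i F v) +
      \sum_(i < m) (iter i F (G (G v)) - iter i F (G v)) +
      \sum_(i < m) (iter i F (G (G (G v))) - iter i F (G (G v))).
    by rewrite -!big_split; apply: eq_bigr => i _; rewrite /len /=; ring.
  have := sum_iter_return_le v mQ; have := sum_iter_return_le (G v) mQ.
  by have := sum_iter_return_le (G (G v)) mQ; lra.
rewrite -natr_sum ler_nat exchange_big /= mulnC -sum1_size big_distrl /=.
apply: leq_sum => e _; rewrite mul1n (leq_trans _ (card_iter_hits_le e v mQ)) //.
rewrite /hit -sum1_card [leqRHS]big_mkcond /= eq_leq //; apply: eq_bigr => i _.
by rewrite inE; case: ifP.
Qed.

End CrossRatioInequality.

(** * Comparability of consecutive steps of a return map *)

Section CrossRatioSpace.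
Context (R : realType).
Implicit Types a b c d l k : R.

(** With [cratio_leR]: a lower bound on the cross-ratio forces each side interval to be a definite
    fraction of its union with the middle one. *)
Lemma cratio_leL a b c d : a < b -> b < c -> c < d ->
  cratio a b c d <= (b - a) / (c - a).
Proof.
move=> ab bc cd; rewrite /cratio invfM mulrACA -[leRHS]mulr1 ler_wpM2l //.
  by rewrite divr_ge0 // subr_ge0; lra.
by rewrite ler_pdivrMr; lra.
Qed.

Lemma cratio_leR a b c d : a < b -> b < c -> c < d ->
  cratio a b c d <= (d - c) / (d - b).
Proof.
move=> ab bc cd; rewrite /cratio invfM mulrACA -[leRHS]mul1r ler_wpM2r //.
  by rewrite divr_ge0 // subr_ge0; lra.
by rewrite ler_pdivrMr; lra.
Qed.

(** Each of the factors [|L| / |L u M|] and [|R| / |M u R|] is at least [1 / (1 + l)]. *)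
Lemma cratio_ge a b c d l : a < b -> b < c -> c < d ->
  c - b <= l * (b - a) -> c - b <= l * (d - c) ->
  ((1 + l) ^+ 2)^-1 <= cratio a b c d.
Proof.
move=> ab bc cd hl hr.
have l0 : 0 < l.
  have : 0 < l * (b - a) by rewrite (lt_le_trans _ hl) ?subr_gt0.
  by rewrite pmulr_lgt0 // subr_gt0.
have -> : cratio a b c d = ((b - a) / (c - a)) * ((d - c) / (d - b)).
  by rewrite /cratio invfM mulrACA.
have i0 : 0 <= (1 + l)^-1 by rewrite invr_ge0 addr_ge0 // ltW.
have ge (x y : R) : 0 < y -> y <= (1 + l) * x -> (1 + l)^-1 <= x / y.
  by move=> y0 h; rewrite ler_pdivlMr // mulrC ler_pdivrMr ?addr_gt0 // mulrC.
rewrite expr2 invfM ler_pM //; apply: ge.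
- by rewrite subr_gt0 (lt_trans ab).
- by rewrite mulrDl mul1r -lerBlDl; apply: le_trans hl; lra.
- by rewrite subr_gt0 (lt_trans bc).
- by rewrite mulrDl mul1r -lerBlDl; apply: le_trans hr; lra.
Qed.

End CrossRatioSpace.
Section ReturnGeometry.
Context (R : realType).
Implicit Types (x y : R) (k l p P : int).

(** The absolute values let the same notion serve for [G], which moves to the right, and for [H],
    which moves to the left. *)
Definition comparable_steps (G : R -> R) (K : R) : Prop := forall x,
  `|G (G x) - G x| <= K * `|G x - x| /\ `|G x - x| <= K * `|G (G x) - G x|.

Context (F : R -> R) (rho : R) (hF : lift_with_rotation F rho).
Context (cs : seq R) (A : R) (hA : cratio_distortion F cs A).
Context (q : nat) (p : int) (Q : nat) (P : int).
Context (hq : consecutive_returns rho q p Q P).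
Local Notation mv := (shifted_iter F).
Local Notation G := (shifted_iter F q p).
Local Notation H := (shifted_iter F Q P).

Definition cratio_bound (A : R) (cs : seq R) : R :=
  expR (A * (6 + (4 * size cs)%:R)).
Local Notation C := (cratio_bound A cs).

Lemma cratio_bound_gt0 : 0 < C. Proof. exact: expR_gt0. Qed.
Let C0 := cratio_bound_gt0.

Lemma shifted_iter_gt x : x < G x.
Proof.
case: hq => _ /andP[t0 _] _ _ _.
by rewrite -{1}[x](shifted_iter00 F) (shifted_iter_lt hF) mul0r add0r.
Qed.

(** The cross-ratio of the images is at least [1 / (1 + r)^2], and by [cratio_iter_le] the original
    one is smaller at most by the factor [C]; hence the middle interval has definite space on both
    sides. *)
Lemma space_pullback v a b c d (m : nat) (r : R) : (m <= Q)%N ->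
  v <= a -> a < b -> b < c -> c < d -> d <= G (G (G v)) ->
  iter m F c - iter m F b <= r * (iter m F b - iter m F a) ->
  iter m F c - iter m F b <= r * (iter m F d - iter m F c) ->
  c - a <= C * (1 + r) ^+ 2 * (b - a) /\ d - b <= C * (1 + r) ^+ 2 * (d - c).
Proof.
move=> mQ va ab bc cd dv hl hr.
have hlt := iter_lift_mono_lt hF m.
have := cratio_ge _ _ _ hl hr; rewrite !hlt => /(_ ab bc cd) h1.
have h2 := le_trans h1 (cratio_iter_le hF hA hq mQ va ab bc cd dv).
have l1 : 0 < 1 + r.
  have : 0 < r * (iter m F b - iter m F a) by rewrite (lt_le_trans _ hl) ?subr_gt0 ?hlt.
  by rewrite pmulr_lgt0 ?subr_gt0 ?hlt // => r0; rewrite addr_gt0.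
have l2 : 0 < (1 + r) ^+ 2 by rewrite exprn_gt0.
have conv u w : 0 < w -> cratio a b c d <= u / w -> w <= C * (1 + r) ^+ 2 * u.
  move=> w0 cu; rewrite mulrAC -ler_pdivrMr // mulrC -ler_pdivlMr //.
  by rewrite -mulrA (le_trans h2) // ler_pM2l.
split; apply: conv.
- by rewrite subr_gt0 (lt_trans ab).
- exact: cratio_leL.
- by rewrite subr_gt0 (lt_trans bc).
- exact: cratio_leR.
Qed.

(** Let [w i] be the highest point below [v] among the translates of [F^m x], [m < Q]. Its image
    under [G], or under [G] followed by the inverse of [H] when [q + i >= Q], is again such a
    translate and lies above [w i], hence not below [v]. The move is at most two steps of [G], as
    [H] moves less than [G]. *)
Lemma iter_visits x v : exists m k, (m < Q)%N /\ v <= mv m k x <= G (G v).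
Proof.
case: (hq) => /andP[q0 qQ] /andP[t0 t1] t'0 tt' _.
pose z m := Num.ceil (v - iter m F x) - 1.
have zP m k : (mv m k x < v) = (k <= z m).
  by rewrite /mv -ltrBrDl -ceil_gt_int /z lerBrDr lezD1.
have Q0 : (0 < Q)%N by apply: leq_trans qQ.
pose w (m : 'I_Q) := mv m (z m) x.
have [i _ imax] := arg_maxP w (isT : predT (Ordinal Q0)).
have wv : w i < v by rewrite zP.
have next m k : (m < Q)%N -> w i < mv m k x -> v <= mv m k x.
  move=> mQ wm; rewrite leNgt zP; apply/negP => kz.
  have : mv m k x <= w (Ordinal mQ) by rewrite /w /mv lerD2l ler_int.
  by move=> /(lt_le_trans wm); rewrite ltNge; move: (imax (Ordinal mQ) isT) => /= ->.
have wGG : G (G (w i)) <= G (G v) by rewrite !(shifted_iter_mono hF) ltW.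
have [iQ|Qi] := ltnP (q + i) Q.
  exists (q + i)%N, (p + z i); split=> //.
  rewrite next // -(shifted_iterD hF) ?shifted_iter_gt //=.
  by rewrite (le_trans _ wGG) // (shifted_iter_mono hF) ltW // shifted_iter_gt.
have iQ : (q + i - Q < Q)%N by rewrite -subn_gt0; have := ltn_ord i; lia.
exists (q + i - Q)%N, (p + z i - P); split=> //.
rewrite next //=; last first.
  rewrite /w (shifted_iter_lt hF) natrB // natrD !rmorphD rmorphN /=.
  by move: t0 t'0 tt'; lra.
rewrite (le_trans _ wGG) // /w !(shifted_iterD hF) (shifted_iter_le hF).
by rewrite natrB // !natrD !rmorphD rmorphN /=; move: t0 t'0 tt'; lra.
Qed.

Lemma min_step_exists : exists z, forall x, G z - z <= G x - x.
Proof.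
apply: (@periodic_min R (fun x => G x - x)) => [x|x].
  by rewrite (_ : x + 1 = x + 1%:~R) // /mv (iter_lift_addz hF); ring.
by apply: cvgB; [exact: (shifted_iter_continuous hF) | exact: cvg_id].
Qed.

(** This is [C (1 + L)^2], where [L] times the shortest step of [G] bounds that step together with
    the two before it. *)
Definition return_ratio (A : R) (cs : seq R) : R :=
  let C := cratio_bound A cs in
  C * (2 + 4 * C + C * (1 + 4 * C) ^+ 2 * (4 * C)) ^+ 2.

Lemma comparable_returns : comparable_steps G (return_ratio A cs).
Proof.
have [z zmin] := min_step_exists; set mu := G z - z in zmin.
have mu0 : 0 < mu by rewrite subr_gt0 shifted_iter_gt.
have Ggt := shifted_iter_gt.
have [x2 x2z] := shifted_iter_surj hF q p z.
have [x1 x1x] := shifted_iter_surj hF q p x2.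
have [x0 x0x] := shifted_iter_surj hF q p x1.
have qQ : (q <= Q)%N by case: hq => /andP[].
have itG a b : iter q F b - iter q F a = G b - G a by rewrite /mv; ring.
have x01 : x0 < x1 by rewrite -x0x Ggt.
have x12 : x1 < x2 by rewrite -x1x Ggt.
have x2z' : x2 < z by rewrite -x2z Ggt.
(* Going backwards from the shortest step, steps grow by a bounded factor. *)
have step2 : z - x2 <= 4 * C * mu.
  (* Minimality of the step [[z, G z]] allows the ratio [1], whence the constant [4 = (1 + 1)^2]. *)
  have [|||_] := @space_pullback x1 x1 x2 z (G z) q 1 qQ (lexx _) x12 x2z' (Ggt z).
  - by rewrite x1x x2z.
  - by rewrite !itG x1x x2z mul1r; have := zmin x2; rewrite x2z.
  - by rewrite !itG x2z mul1r; exact: zmin.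
  by have := Ggt z; rewrite -/mu expr2; lra.
have C4 : 0 < 4 * C by rewrite mulr_gt0.
have t0 : 0 < C * (1 + 4 * C) ^+ 2 by rewrite mulr_gt0 // exprn_gt0 // addr_gt0.
have step1 : x2 - x1 <= C * (1 + 4 * C) ^+ 2 * (4 * C) * mu.
  have [|||_] := @space_pullback x0 x0 x1 x2 z q (4 * C) qQ (lexx _) x01 x12 x2z'.
  - by rewrite x0x x1x x2z.
  - rewrite !itG x0x x1x x2z (le_trans step2) // ler_pM2l //.
    by have := zmin x1; rewrite x1x.
  - by rewrite !itG x1x x2z.
  by rewrite -(ler_pM2l t0) in step2; lra.
pose L := 1 + 4 * C + C * (1 + 4 * C) ^+ 2 * (4 * C).
have L0 : 0 < L by rewrite /L addr_gt0 ?addr_gt0 // mulr_gt0.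
(* [iter_visits] brings [x] into [[x0, x2]] at some time [m < Q]. Then the image of [[G x, G (G x)]]
   lies in [[x1, G z]], of length at most [L * mu], while both neighbouring images have length at
   least [mu]. *)
have main x : G (G x) - x <= return_ratio A cs * (G x - x) /\
    G (G (G x)) - G x <= return_ratio A cs * (G (G (G x)) - G (G x)).
  have [m [k [mQ /andP[wl wr]]]] := iter_visits x x0.
  have mG y : mv m k (G y) = G (mv m k y) by rewrite !(shifted_iterD hF) addnC addrC.
  have itm a b : iter m F b - iter m F a = mv m k b - mv m k a by rewrite /mv; ring.
  have Ggt' y : mv m k y < mv m k (G y) by rewrite mG Ggt.
  have mL y : L * mu <= L * (mv m k (G y) - mv m k y).
    by rewrite ler_pM2l // mG zmin.
  have mid : mv m k (G (G x)) - mv m k (G x) <= L * mu.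
    have h1 : x1 <= mv m k (G x) by rewrite mG -x0x (shifted_iter_mono hF).
    have : mv m k (G (G x)) <= G z.
      by rewrite !mG -x2z -x1x -x0x !(shifted_iter_mono hF).
    by rewrite x0x x1x in wr; rewrite /L; move: step1 step2; rewrite /mu; lra.
  have -> : return_ratio A cs = C * (1 + L) ^+ 2.
    by rewrite /return_ratio /L; congr (_ * _ ^+ _); ring.
  apply: (@space_pullback x x _ _ _ m L (ltnW mQ)) => //; rewrite ?itm ?lexx //.
    exact: le_trans mid (mL _).
  exact: le_trans mid (mL _).
move=> x; rewrite !gtr0_norm ?subr_gt0 ?Ggt //.
have [y <-] := shifted_iter_surj hF q p x.
have [h1 h2] := main (G y); have [h3 h4] := main y.
by move: h1 h2 h3 h4 (Ggt y) (Ggt (G y)) (Ggt (G (G y))); split; lra.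
Qed.

End ReturnGeometry.

(** * Critical points *)

Section CriticalReturns.
Context (R : realType).
Implicit Types (x y : R) (k l p P : int).

(** The integrated form of non-flatness. It is asked for all [t <= 1], and not only near [c], so
    that it applies to steps of every size. *)
Definition power_law (F : R -> R) (c alpha beta s : R) : Prop :=
  [/\ 0 < alpha, 0 < beta, 1 < s & forall t, 0 < t <= 1 ->
    alpha * t `^ s <= F (c + t) - F c <= beta * t `^ s /\
    alpha * t `^ s <= F c - F (c - t) <= beta * t `^ s].

Context (F : R -> R) (rho : R) (hF : lift_with_rotation F rho).
Context (cs : seq R) (A : R) (hA : cratio_distortion F cs A).
Context (q : nat) (p : int) (Q : nat) (P : int).
Context (hq : consecutive_returns rho q p Q P).
Local Notation mv := (shifted_iter F).
Local Notation G := (shifted_iter F q p).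
Local Notation H := (shifted_iter F Q P).
Local Notation C := (cratio_bound A cs).

Context (K : R).
Hypothesis (GK : comparable_steps G K) (HK : comparable_steps H K).

Let Ggt x : x < G x. Proof. exact: (shifted_iter_gt hF hq). Qed.

Let Hlt x : H x < x.
Proof.
case: hq => _ _ t' _ _.
by rewrite -{2}[x](shifted_iter00 F) (shifted_iter_lt hF) mul0r add0r.
Qed.

Let GH x : G (H x) = H (G x).
Proof. by rewrite !(shifted_iterD hF) addnC addrC. Qed.

Let GHgt x : x < G (H x).
Proof.
case: hq => _ _ _ tt _.
rewrite (shifted_iterD hF) -{1}[x](shifted_iter00 F) (shifted_iter_lt hF).
by rewrite mul0r add0r natrD rmorphD /=; lra.
Qed.

Let Gle : {mono G : x y / x <= y}. Proof. exact: (shifted_iter_mono hF). Qed.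
Let Hle : {mono H : x y / x <= y}. Proof. exact: (shifted_iter_mono hF). Qed.

Let G1 x : G (G x) - G x <= K * (G x - x).
Proof. by have [+ _] := GK x; rewrite !gtr0_norm ?subr_gt0. Qed.

Let G2 x : G x - x <= K * (G (G x) - G x).
Proof. by have [_ +] := GK x; rewrite !gtr0_norm ?subr_gt0. Qed.

Let H1 x : H x - H (H x) <= K * (x - H x).
Proof. by have [+ _] := HK x; rewrite !ltr0_norm ?subr_lt0 // !opprB. Qed.

Let H2 x : x - H x <= K * (H x - H (H x)).
Proof. by have [_ +] := HK x; rewrite !ltr0_norm ?subr_lt0 // !opprB. Qed.

Let K0 : 0 < K.
Proof.
have : 0 < K * (G 0 - 0) by rewrite (lt_le_trans _ (G1 0)) // subr_gt0.
by rewrite pmulr_lgt0 // subr_gt0.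
Qed.

(** Solving [k * eps <= C * (beta / alpha) * eps^s] for the ratio [eps] of [|[Hc, c]|] to
    [|[c, Gc]|] gives a lower bound for [eps]; this is its inverse. *)
Definition critical_ratio (K alpha beta s : R) : R :=
  let k := (K * (1 + K) * (1 + K * (1 + K) ^+ 2))^-1 in
  (k * alpha / (cratio_bound A cs * beta)) `^ (- (s - 1)^-1).

Lemma critical_return_le c alpha beta s : power_law F c alpha beta s ->
  G c - c <= critical_ratio K alpha beta s * (c - H c).
Proof.
move=> [a0 b0 s1 law].
have C0 := cratio_bound_gt0 cs A.
case: (hq) => /andP[q0 qQ] /andP[_ t1] _ tt _.
set e := c - H c; set E := G c - c.
have e0 : 0 < e by rewrite subr_gt0.
have E0 : 0 < E by rewrite subr_gt0.
have E1 : E <= 1.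
  rewrite lerBlDl; have -> : c + 1 = mv 0 1 c by [].
  by rewrite (shifted_iter_le hF) mul0r add0r ltW.
have e1 : e <= 1.
  rewrite lerBlDl -lerBlDr; have -> : c - 1 = mv 0 (-1) c by rewrite /mv /= rmorphN.
  by rewrite (shifted_iter_le hF) mul0r add0r rmorphN /=; lra.
(* The step of [G] at [H c] passes [c], so it is longer than [[H c, c]]; comparability carries the
   bound over to the step at [c]. *)
have eE : e <= K * (1 + K) * E.
  have h1 : H c < c by [].
  have h2 : e <= G (H c) - H c by rewrite lerD2r ltW.
  have h3 : G (H c) <= G c by rewrite Gle ltW.
  have h4 := G2 (H c); have h5 : G (G (H c)) <= G (G c) by rewrite !Gle ltW.
  have h6 := G1 c; have h7 := GHgt c.
  rewrite (le_trans h2) // (le_trans h4) // -mulrA ler_pM2l //.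
  by rewrite mulrDl mul1r /E; lra.
have FQ y : F y = iter 1 F y by [].
have itQ a b : iter Q.-1 F (F b) - iter Q.-1 F (F a) = H b - H a.
  by rewrite -!iterSr prednK ?(leq_trans q0) // /mv; ring.
have Flt := iter_lift_mono_lt hF 1%N.
have GF y : G (F y) = F (G y).
  by rewrite /mv -iterSr iterS (lift_addz hF).
have eps0 : 0 < e / E by rewrite divr_gt0.
have dQ : (Q.-1 <= Q)%N by exact: leq_pred.
have := cratio_iter_le hF hA hq dQ (lexx (F (H c))).
move=> /(_ (F c) (F (G c)) (F (G (G c)))); rewrite !Flt !Ggt Hlt => /(_ isT isT isT).
rewrite !GF (iter_lift_mono hF 1%N) !Gle ltW // => /(_ isT).
rewrite -/(cratio_bound A cs) => hC.
(* The left factor of the cross-ratio already gains the exponent [s]: its numerator is at most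
   [beta * e^s] and its denominator at least [alpha * E^s]. *)
have up : cratio (F (H c)) (F c) (F (G c)) (F (G (G c))) <=
    beta / alpha * (e / E) `^ s.
  rewrite (le_trans (cratio_leL _ _ _)) ?Flt //.
  have /andP[_ hb] := (law e (introT andP (conj e0 e1))).2.
  have /andP[ha _] := (law E (introT andP (conj E0 E1))).1.
  have es0 := powR_ge0 e s.
  have Es0 : 0 < E `^ s by exact: powR_gt0.
  have -> : (e / E) `^ s = e `^ s / E `^ s.
    apply: (canRL (mulfK (lt0r_neq0 Es0))).
    by rewrite -powRM ?divfK ?lt0r_neq0 // ltW.
  have hcG : F (H c) < F (G c) by rewrite Flt (lt_trans (Hlt _)).
  rewrite mulf_div; apply: ler_pM.
  - by rewrite subr_ge0 ltW // Flt.
  - by rewrite invr_ge0 subr_ge0 ltW.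
  - by rewrite /e subKr in hb.
  rewrite lef_pV2 ?posrE ?mulr_gt0 ?subr_gt0 //.
  rewrite /E subrKC in ha; rewrite (le_trans ha) //.
  by rewrite lerB // ltW // Flt.
(* Up to an integer, [F^(Q-1)] takes the four image points to the images of [H c], [c], [G c],
   [G (G c)] under [H]. The left interval is at least [e / K], its union with the middle one at most
   [M * E], and the right factor at least [1 / (1 + K)]. *)
have down : (K * (1 + K) * (1 + K * (1 + K) ^+ 2))^-1 * (e / E) <=
    cratio (iter Q.-1 F (F (H c))) (iter Q.-1 F (F c))
      (iter Q.-1 F (F (G c))) (iter Q.-1 F (F (G (G c)))).
  rewrite /cratio !itQ; set M := 1 + K * (1 + K) ^+ 2.
  have M0 : 0 < M by rewrite addr_gt0 // mulr_gt0 // exprn_gt0 // addr_gt0.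
  have K1 : 0 < 1 + K by rewrite addr_gt0.
  have h1 : e <= K * (H c - H (H c)) by exact: H2.
  have h2 : H (G c) - H (H c) <= M * E.
    have := eE; rewrite -(ler_pM2l K1) => eE'.
    have h3 := H1 c; have h4 := Hlt (G c).
    have -> : M * E = E + (1 + K) * (K * (1 + K) * E) by rewrite /M; ring.
    apply: le_trans (_ : E + (1 + K) * e <= _); last by rewrite lerD2l.
    by rewrite mulrDl mul1r; move: h3 h4; rewrite -/e /E /e; lra.
  have h3 : H (G (G c)) - H c <= (1 + K) * (H (G (G c)) - H (G c)).
    by rewrite -!GH; have := G2 (H c); lra.
  have D1 : 0 < H (G c) - H (H c).
    by rewrite subr_gt0 -GH; apply: lt_trans (Hlt _) (Ggt _).
  have D2 : 0 < H (G (G c)) - H c.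
    by rewrite subr_gt0 -!GH; apply: lt_trans (Ggt _) (Ggt _).
  have D3 : 0 < H (G (G c)) - H (G c) by rewrite subr_gt0 -!GH Ggt.
  rewrite ler_pdivlMr ?mulr_gt0 //.
  have k0 : 0 < (K * (1 + K) * M)^-1 by rewrite invr_gt0 !mulr_gt0.
  apply: (@le_trans _ _ ((K * (1 + K) * M)^-1 * (e / E) *
      ((M * E) * ((1 + K) * (H (G (G c)) - H (G c)))))).
    by rewrite ler_pM2l ?(mulr_gt0 k0) // ler_pM // ltW.
  have -> : (K * (1 + K) * M)^-1 * (e / E) *
      ((M * E) * ((1 + K) * (H (G (G c)) - H (G c)))) =
      e / K * (H (G (G c)) - H (G c)).
    by field; rewrite !lt0r_neq0.
  by rewrite ler_pM2r // ler_pdivrMr // mulrC.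
have s10 : 0 < s - 1 by rewrite subr_gt0.
rewrite /critical_ratio; set k := (_ * _ * _)^-1 in down *.
have K1 : 0 < 1 + K by rewrite addr_gt0.
have k0 : 0 < k.
  rewrite invr_gt0; apply: mulr_gt0; first exact: mulr_gt0.
  by apply: addr_gt0 => //; apply: mulr_gt0 => //; apply: exprn_gt0.
have : k * alpha / (C * beta) <= (e / E) `^ (s - 1).
  have h := le_trans down (le_trans hC (ler_wpM2l (ltW C0) up)).
  rewrite -mulr_powRB1 ?(ltW eps0) // in h; last exact: lt_trans s1.
  rewrite ler_pdivrMr ?mulr_gt0 // -(ler_pM2r eps0).
  rewrite mulrAC -ler_pdivlMr //; apply: le_trans h _.
  by rewrite le_eqVlt; apply/orP; left; apply/eqP; field; rewrite !lt0r_neq0.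
set eta := k * alpha / _ => h.
have eta0 : 0 < eta by rewrite !mulr_gt0 // invr_gt0 mulr_gt0.
have : eta `^ (s - 1)^-1 <= e / E.
  have := ge0_ler_powR (_ : 0 <= (s - 1)^-1) _ _ h.
  rewrite -powRrM divff ?lt0r_neq0 // powRr1 ?(ltW eps0) //.
  by apply; rewrite ?invr_ge0 ?nnegrE ?(ltW eta0) ?powR_ge0 // ltW.
by rewrite powRN ler_pdivlMr // ler_pdivlMl // powR_gt0.
Qed.

Definition pullback_ratio (K K2 : R) : R :=
  K * (1 + K) * (cratio_bound A cs * (1 + (K + (1 + K) ^+ 2 * K2)) ^+ 2).

(** With [w = F^j u], the point [c] lies in [[H w, w]], so the estimate at [c] carries over to [w]:
    [[w, G w]] is at most [r] times each of [[H w, w]] and [[G w, G (G w)]]. This space is pulled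
    back by [F^j] to [H u], [u], [G u], [G (G u)]. *)
Lemma step_hitting_critical_ge x u z c (j : nat) (K2 : R) : (j < Q)%N ->
  x <= u <= G x -> H u <= z <= u -> iter j F z = c ->
  G c - c <= K2 * (c - H c) ->
  G x - x <= pullback_ratio K K2 * (u - H u).
Proof.
move=> jQ /andP[xu ux] /andP[Hz zu] zc hc.
have K20 : 0 < K2.
  by rewrite -(pmulr_lgt0 _ (_ : 0 < c - H c)) ?subr_gt0 // (lt_le_trans _ hc) ?subr_gt0.
set w := iter j F u.
have jG y : iter j F (G y) = G (iter j F y).
  have e v : iter j F v = mv j 0 v by rewrite /mv addr0.
  by rewrite !e !(shifted_iterD hF) addnC addrC.
have jH y : iter j F (H y) = H (iter j F y).
  have e v : iter j F v = mv j 0 v by rewrite /mv addr0.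
  by rewrite !e !(shifted_iterD hF) addnC addrC.
have Hwc : H w <= c by rewrite /w -jH -zc (iter_lift_mono hF).
have cw : c <= w by rewrite /w -zc (iter_lift_mono hF).
have wGc : w <= G c by rewrite (le_trans (ltW (GHgt w))) // Gle.
have K1 : 0 < 1 + K by rewrite addr_gt0.
set r := K + (1 + K) ^+ 2 * K2.
have L : G w - w <= r * (w - H w).
  have h1 : G w - w <= (1 + K) * (G c - c).
    have h0 : G w <= G (G c) by rewrite Gle.
    by have := G1 c; lra.
  have h2 : (1 + K) * (G c - c) <= (1 + K) * (K2 * (c - H c)) by rewrite ler_pM2l.
  have h3 : c - H c <= (1 + K) * (w - H w).
    have h0 : H (H w) <= H c by rewrite Hle.
    by have := H1 w; lra.
  have h4 : (1 + K) * (K2 * (c - H c)) <= (1 + K) * (K2 * ((1 + K) * (w - H w))).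
    by rewrite !ler_pM2l.
  have h5 : 0 <= K * (w - H w) by rewrite mulr_ge0 ?subr_ge0 // ltW.
  by rewrite (le_trans h1) // (le_trans h2) // (le_trans h4) // /r; lra.
have M : G w - w <= r * (G (G w) - G w).
  have h : 0 <= (1 + K) ^+ 2 * K2 * (G (G w) - G w).
    by rewrite !mulr_ge0 ?subr_ge0 ?exprn_ge0 // ltW.
  by have := G2 w; rewrite /r; lra.
have d3 : G (G u) <= G (G (G (H u))) by rewrite !Gle ltW.
have [] := @space_pullback _ _ _ hF _ _ hA _ _ _ _ hq (H u) (H u) u (G u) (G (G u))
  j r (ltnW jQ) (lexx _) (Hlt u) (Ggt u) (Ggt (G u)) d3.
- by rewrite !jG jH.
- by rewrite !jG.
rewrite -/(cratio_bound A cs); set D := cratio_bound A cs * _ => h _.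
have h1 : G u - u <= D * (u - H u) by have := Hlt u; lra.
have h2 : G (G x) - G x <= (1 + K) * (G u - u).
  have h0 : G (G x) <= G (G u) by rewrite !Gle.
    by have := G1 u; lra.
have h3 : (1 + K) * (G u - u) <= (1 + K) * (D * (u - H u)) by rewrite ler_pM2l.
have -> : pullback_ratio K K2 * (u - H u) = K * ((1 + K) * (D * (u - H u))).
  by rewrite /pullback_ratio -/r -/D; ring.
by rewrite (le_trans (G2 x)) // ler_pM2l // (le_trans h2).
Qed.

End CriticalReturns.

(** * Reflection of the orientation *)

Section Reflection.
Context (R : realType).
Implicit Types (F : R -> R) (rho x y u z : R) (k p P : int).

Definition reflect_map F : R -> R := fun x => - F (- x).

(** The second alternative is the first one for the reflected map, whose rotation number is [- rho];
    it covers the returns for which [G] moves to the left. *)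
Definition oriented_returns rho (q : nat) (p : int) (Q : nat) (P : int) : Prop :=
  consecutive_returns rho q p Q P \/ consecutive_returns (- rho) q (- p) Q (- P).

(** The endpoints come in either order, which makes the condition invariant under reflection. *)
Definition between x y z : bool := (x <= z <= y) || (y <= z <= x).

Lemma iter_reflect F a x : iter a (reflect_map F) x = - iter a F (- x).
Proof. by elim: a => [|a IH] /=; rewrite ?opprK // IH /reflect_map opprK. Qed.

Lemma shifted_iter_reflect F a k x :
  shifted_iter (reflect_map F) a (- k) x = - shifted_iter F a k (- x).
Proof. by rewrite /shifted_iter iter_reflect rmorphN /= opprD. Qed.

Lemma lift_with_rotation_reflect F rho :
  lift_with_rotation F rho -> lift_with_rotation (reflect_map F) (- rho).
Proof.
move=> hF; have [mF pF cF sF rF] := hF; split.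
- by move=> x y; rewrite lerN2 mF lerN2.
- move=> x; rewrite /reflect_map opprD -{2}[- x](subrK 1) pF; lra.
- move=> x; apply: cvgN; apply: (@continuous_comp _ _ _ -%R F); last exact: cF.
  exact: opp_continuous.
- by move=> y; have [x hx] := sF (- y); exists (- x); rewrite /reflect_map opprK hx opprK.
- move=> a k x; rewrite -[k]opprK shifted_iter_reflect.
  have [h1 h2] := rF a (- k) (- x).
  rewrite ltrNr ltrNl h1 h2 !rmorphN /= !mulrN.
  rewrite -[LHS in (LHS = _) /\ _]oppr_gt0 -[LHS in _ /\ (LHS = _)]oppr_lt0.
  by split; congr (_ < _); ring.
Qed.

Lemma cratio_opp (a b c d : R) : cratio (- d) (- c) (- b) (- a) = cratio a b c d.
Proof. by rewrite /cratio; congr (_ / _); ring. Qed.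

Lemma cratio_distortion_reflect F (cs : seq R) A :
  cratio_distortion F cs A -> cratio_distortion (reflect_map F) (map -%R cs) A.
Proof.
move=> [A0 h1 h2]; split=> // a b c d ab bc cd; rewrite /reflect_map cratio_opp.
  by rewrite -(cratio_opp a); apply: h1; rewrite ltrN2.
move=> hcs; have -> : d - a = - a - - d by ring.
rewrite -(cratio_opp a).
apply: h2; rewrite ?ltrN2 // => e k ecs.
have := hcs (- e) (- k) (map_f _ ecs).
rewrite rmorphN /=; apply: contra => /andP[h3 h4].
by apply/andP; split; lra.
Qed.

Lemma power_law_reflect F c alpha beta s :
  power_law F c alpha beta s -> power_law (reflect_map F) (- c) alpha beta s.
Proof.
move=> [a0 b0 s1 h]; split=> // t t01; have [h1 h2] := h t t01.
rewrite /reflect_map !opprD !opprK; split.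
  by rewrite addrC.
by rewrite addrC.
Qed.

End Reflection.

(** Since the condition only weakens as the constant grows, a maximum serves a whole finite list;
    this makes bounds uniform over the finitely many critical points. *)
Lemma uniform_bound (R : realType) (T : eqType) (l : seq T) (P : T -> R -> Prop) :
  (forall e r r', r <= r' -> P e r -> P e r') ->
  (forall e, e \in l -> exists r, P e r) ->
  exists2 r, 0 < r & forall e, e \in l -> P e r.
Proof.
move=> Pmono; elim: l => [|e l IH] hl; first by exists 1.
have [f fl|r r0 hr] := IH; first by apply: hl; rewrite inE fl orbT.
have [r' hr'] := hl e (mem_head _ _); exists (Num.max r r'); first by rewrite lt_max r0.
move=> f; rewrite inE => /predU1P[->|/hr hf].
  by apply: Pmono hr'; rewrite le_max lexx orbT.
by apply: Pmono hf; rewrite le_max lexx.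
Qed.

(** * Estimates for returns of either orientation *)

Section OrientedReturns.
Context (R : realType).
Implicit Types (F : R -> R) (rho x y u z : R) (k p P : int).

Lemma comparable_steps_reflect F (q : nat) p K :
  comparable_steps (shifted_iter (reflect_map F) q (- p)) K ->
  comparable_steps (shifted_iter F q p) K.
Proof.
move=> h x; have := h (- x).
have dist (a b : R) : `|- a + b| = `|a - b| by rewrite addrC distrC.
by rewrite !shifted_iter_reflect !opprK !dist.
Qed.

Lemma oriented_comparable F rho cs A q p Q P :
  lift_with_rotation F rho -> cratio_distortion F cs A ->
  oriented_returns rho q p Q P ->
  comparable_steps (shifted_iter F q p) (return_ratio A cs).
Proof.
move=> hF hA [h|h]; first exact: (comparable_returns hF hA h).
apply: comparable_steps_reflect.
have := comparable_returns (lift_with_rotation_reflect hF)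
  (cratio_distortion_reflect hA) h.
by rewrite /return_ratio /cratio_bound size_map.
Qed.

Definition hit_ratio (cs : seq R) (A alpha beta s : R) : R :=
  let K := return_ratio A cs in
  pullback_ratio cs A K (critical_ratio cs A K alpha beta s).

(** Translation by [- k] reduces to a hit of [c] itself. The further return [(Q', P')] is there to
    make the steps of [H] comparable too. *)
Lemma positive_hit_le F rho cs A q p Q P Q' P' c alpha beta s x u z k (j : nat) :
  lift_with_rotation F rho -> cratio_distortion F cs A ->
  consecutive_returns rho q p Q P -> oriented_returns rho Q P Q' P' ->
  power_law F c alpha beta s -> (j < Q)%N ->
  between x (shifted_iter F q p x) u -> between u (shifted_iter F Q P u) z ->
  iter j F z = c + k%:~R ->
  `|shifted_iter F q p x - x| <=
    hit_ratio cs A alpha beta s * `|shifted_iter F Q P u - u|.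
Proof.
move=> hF hA hq hQ law jQ xu uz hz.
have GK := comparable_returns hF hA hq.
have HK := oriented_comparable hF hA hQ.
have Gx := shifted_iter_gt hF hq x.
have Hu : shifted_iter F Q P u < u.
  case: hq => _ _ t' _ _.
  by rewrite -{2}[u](shifted_iter00 F) (shifted_iter_lt hF) mul0r add0r.
have shift a l y : shifted_iter F a l (y - k%:~R) = shifted_iter F a l y - k%:~R.
  by rewrite /shifted_iter -rmorphN (iter_lift_addz hF) addrAC.
rewrite gtr0_norm ?subr_gt0 // ltr0_norm ?subr_lt0 // opprB.
have xu' : x - k%:~R <= u - k%:~R <= shifted_iter F q p (x - k%:~R).
  by rewrite shift; case/orP: xu => /andP[h1 h2]; apply/andP; split; lra.
have uz' : shifted_iter F Q P (u - k%:~R) <= z - k%:~R <= u - k%:~R.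
  by rewrite shift; case/orP: uz => /andP[h1 h2]; apply/andP; split; lra.
have zc : iter j F (z - k%:~R) = c.
  by rewrite -rmorphN (iter_lift_addz hF) hz rmorphN addrK.
have := step_hitting_critical_ge hF hA hq GK HK jQ xu' uz' zc
  (critical_return_le hF hA hq GK HK law).
by rewrite !shift !opprB !addrA !subrK.
Qed.

Lemma oriented_hit_le F rho cs A q p Q P Q' P' c alpha beta s x u z k (j : nat) :
  lift_with_rotation F rho -> cratio_distortion F cs A ->
  oriented_returns rho q p Q P -> oriented_returns rho Q P Q' P' ->
  power_law F c alpha beta s -> (j < Q)%N ->
  between x (shifted_iter F q p x) u -> between u (shifted_iter F Q P u) z ->
  iter j F z = c + k%:~R ->
  `|shifted_iter F q p x - x| <=
    hit_ratio cs A alpha beta s * `|shifted_iter F Q P u - u|.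
Proof.
move=> hF hA [hq|hq]; first exact: positive_hit_le hF hA hq.
move=> hQ law jQ xu uz hz.
have hQ' : oriented_returns (- rho) Q (- P) Q' (- P').
  by case: hQ => h; [right; rewrite !opprK | left].
have betweenN y1 y2 y3 : between (- y1) (- y2) (- y3) = between y1 y2 y3.
  by rewrite /between !lerN2 orbC andbC [X in _ || X]andbC.
have := @positive_hit_le _ _ _ A _ _ _ _ _ _ _ _ _ _ (- x) (- u) (- z) (- k) j
  (lift_with_rotation_reflect hF) (cratio_distortion_reflect hA) hq hQ'
  (power_law_reflect law) jQ.
rewrite !shifted_iter_reflect !opprK !betweenN iter_reflect opprK hz.
move=> /(_ xu uz); rewrite rmorphN opprD => /(_ erefl).
have dist (a b : R) : `|- a + b| = `|a - b| by rewrite addrC distrC.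
rewrite !dist => h; apply: le_trans h _.
by rewrite /hit_ratio /pullback_ratio /critical_ratio /return_ratio /cratio_bound size_map.
Qed.

(** [K] is chosen before the return times, the critical point and the hitting time; this order of
    quantifiers is the uniformity in [n]. *)
Lemma hit_le F rho cs A : lift_with_rotation F rho -> cratio_distortion F cs A ->
  (forall c, c \in cs -> exists alpha beta s, power_law F c alpha beta s) ->
  exists2 K, 0 < K & forall q p Q P Q' P' c x u z k (j : nat),
    oriented_returns rho q p Q P -> oriented_returns rho Q P Q' P' ->
    c \in cs -> (j < Q)%N ->
    between x (shifted_iter F q p x) u -> between u (shifted_iter F Q P u) z ->
    iter j F z = c + k%:~R ->
    `|shifted_iter F q p x - x| <= K * `|shifted_iter F Q P u - u|.
Proof.
move=> hF hA hcs.
have [||K K0 hK] := @uniform_bound R _ cs (fun c K => exists alpha beta s,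
    power_law F c alpha beta s /\ hit_ratio cs A alpha beta s <= K).
- move=> c K K' KK' [alpha [beta [s [law le]]]].
  by exists alpha, beta, s; rewrite (le_trans le).
- move=> c /hcs[alpha [beta [s law]]].
  by exists (hit_ratio cs A alpha beta s), alpha, beta, s.
exists K => // q p Q P Q' P' c x u z k j hq hQ ccs jQ xu uz hz.
have [alpha [beta [s [law sK]]]] := hK c ccs.
by rewrite (le_trans (oriented_hit_le hF hA hq hQ law jQ xu uz hz)) // ler_wpM2r.
Qed.

End OrientedReturns.

(** * Maps with negative Schwarzian derivative *)

Section RealDerivatives.
Context (R : realType).
Implicit Types (f g : R -> R) (x a b : R).

Lemma is_derive_mulr f g x (df dg : R) : is_derive x 1 f df -> is_derive x 1 g dg ->
  is_derive x 1 (fun y => f y * g y) (df * g x + f x * dg).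
Proof.
move=> hf hg; apply: is_derive_eq (is_deriveM hf hg) _.
by rewrite addrC /GRing.scale /= [g x * _]mulrC.
Qed.

Lemma is_derive_ln_comp f x (df : R) : 0 < f x -> is_derive x 1 f df ->
  is_derive x 1 (fun y => ln (f y)) (df / f x).
Proof.
move=> f0 hf; apply: is_derive_eq (is_derive1_comp (is_derive1_ln f0) hf) _.
by rewrite mulrC.
Qed.

Lemma is_derive_invr f x (df : R) : f x != 0 -> is_derive x 1 f df ->
  is_derive x 1 (fun y => (f y)^-1) (- df / f x ^+ 2).
Proof.
move=> f0 hf; apply: is_derive_eq (is_deriveV f0 hf) _.
by rewrite /GRing.scale /= mulrC mulrN mulNr.
Qed.

Lemma is_derive_subr f g x (df dg : R) : is_derive x 1 f df -> is_derive x 1 g dg ->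
  is_derive x 1 (fun y => f y - g y) (df - dg).
Proof. exact: is_deriveB. Qed.

Lemma is_derive_subc f x (c df : R) : is_derive x 1 f df ->
  is_derive x 1 (fun y => f y - c) df.
Proof.
by move=> hf; apply: is_derive_eq (is_deriveB hf (is_derive_cst c x 1)) _; rewrite subr0.
Qed.

Lemma is_derive_addc f x (c df : R) : is_derive x 1 f df ->
  is_derive x 1 (fun y => f y + c) df.
Proof.
by move=> hf; apply: is_derive_eq (is_deriveD hf (is_derive_cst c x 1)) _; rewrite addr0.
Qed.

Lemma is_derive_csub f x (c df : R) : is_derive x 1 f df ->
  is_derive x 1 (fun y => c - f y) (- df).
Proof.
by move=> hf; apply: is_derive_eq (is_deriveB (is_derive_cst c x 1) hf) _; rewrite sub0r.
Qed.

Lemma mean_value f (f' : R -> R) a b : a < b ->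
  (forall x, a <= x <= b -> is_derive x 1 f (f' x)) ->
  exists2 x, a < x < b & f b - f a = f' x * (b - a).
Proof.
move=> ab hf.
have [||x] := @MVT R f f' a b ab; first by
  move=> x /itvP xab; apply: hf; rewrite !ltW ?xab.
  apply: derivable_within_continuous => x; rewrite in_itv /= => /hf[].
  by [].
by rewrite in_itv /= => xab e; exists x.
Qed.

Lemma nondecreasing_of_derive f (f' : R -> R) a b : a <= b ->
  (forall x, a <= x <= b -> is_derive x 1 f (f' x)) ->
  (forall x, a < x < b -> 0 <= f' x) -> f a <= f b.
Proof.
rewrite le_eqVlt => /predU1P[-> //|ab] hf f'0.
have [x xab e] := mean_value ab hf.
by rewrite -subr_ge0 e mulr_ge0 ?f'0 // subr_ge0 ltW.
Qed.

End RealDerivatives.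

Section NegativeSchwarzian.
Context (R : realType) (F F1 F2 F3 : R -> R) (a d : R).
Hypothesis dF : forall x, a <= x <= d -> is_derive x 1 F (F1 x).
Hypothesis dF1 : forall x, a <= x <= d -> is_derive x 1 F1 (F2 x).
Hypothesis dF2 : forall x, a <= x <= d -> is_derive x 1 F2 (F3 x).
Hypothesis F1_gt0 : forall x, a <= x <= d -> 0 < F1 x.
Hypothesis schwarzian_lt0 : forall x, a <= x <= d ->
  F3 x / F1 x - 3 / 2 * (F2 x / F1 x) ^+ 2 < 0.

Let F_lt x y : a <= x -> x < y -> y <= d -> F x < F y.
Proof.
move=> ax xy yd; have [|z /andP[xz zy] e] := @mean_value R F F1 x y xy.
  by move=> z /andP[xz zy]; apply: dF; rewrite (le_trans ax) // (le_trans zy).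
rewrite -subr_gt0 e mulr_gt0 ?subr_gt0 // F1_gt0 // (le_trans ax) ?ltW //.
exact: lt_le_trans zy yd.
Qed.

(* With [phi] the inverse square root of [F1], negativity of the Schwarzian
   makes [(F - F x) * phi] convex to the right of [x]. *)
Lemma derivative_product_le x y : a <= x -> x < y -> y <= d ->
  F1 x * F1 y * (y - x) ^+ 2 <= (F y - F x) ^+ 2.
Proof.
move=> ax xy yd.
pose phi t := expR (- 2^-1 * ln (F1 t)).
have dphi t : a <= t <= d -> is_derive t 1 phi (phi t * (- 2^-1 * (F2 t / F1 t))).
  move=> td; have F1t := F1_gt0 td.
  have h := is_derive_mulr (is_derive_cst (- 2^-1 : R) t 1)
    (is_derive_ln_comp F1t (dF1 td)).
  apply: is_derive_eq (is_derive1_comp (is_derive_expR _) h) _.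
  by rewrite mul0r add0r.
have phi0 t : 0 < phi t by exact: expR_gt0.
have phi2 t : a <= t <= d -> phi t ^+ 2 = (F1 t)^-1.
  move=> td; rewrite /phi -expRM_natl mulrA mulrN divff // mulN1r expRN lnK //.
  by rewrite posrE F1_gt0.
pose g t := phi t * (F1 t - (F t - F x) * (2^-1 * (F2 t / F1 t))).
have du t : a <= t <= d -> is_derive t 1 (fun t => (F t - F x) * phi t) (g t).
  move=> td; apply: is_derive_eq (is_derive_mulr (is_derive_subc _ (dF td)) (dphi t td)) _.
  by rewrite /g; ring.
(* For [u t = (F t - F x) * phi t], with derivative [g], this says [u'' = - (S / 2) u], where [S] is
   the Schwarzian derivative of [F]; the sign of [S] makes [g] nondecreasing. *)
pose g' t := phi t * (F t - F x) * (- 2^-1 *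
  (F3 t / F1 t - 3 / 2 * (F2 t / F1 t) ^+ 2)).
have dg t : a <= t <= d -> is_derive t 1 g (g' t).
  move=> td; have F1t := lt0r_neq0 (F1_gt0 td).
  have h1 := is_derive_mulr (dF2 td) (is_derive_invr F1t (dF1 td)).
  have h2 := is_derive_mulr (is_derive_cst (2^-1 : R) t 1) h1.
  have h3 := is_derive_mulr (is_derive_subc (F x) (dF td)) h2.
  apply: is_derive_eq (is_derive_mulr (dphi t td) (is_derive_subr (dF1 td) h3)) _.
  by rewrite /g' /=; field.
have sub t : x <= t <= y -> a <= t <= d.
  by move=> /andP[h1 h2]; rewrite (le_trans ax) // (le_trans h2).
have g_le t : x <= t <= y -> g x <= g t.
  move=> /andP[xt ty]; have sub' s : x <= s <= t -> a <= s <= d.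
    by move=> /andP[h1 h2]; rewrite sub // h1 (le_trans h2).
  apply: (@nondecreasing_of_derive R g g' x t xt) => [s /sub'/dg //|s /andP[xs st]].
  have sd : a <= s <= d by rewrite sub' // !ltW.
  apply: mulr_ge0; first (apply: mulr_ge0; first exact: ltW).
    by rewrite subr_ge0 ltW // F_lt //; case/andP: sd.
  by rewrite mulNr oppr_ge0 pmulr_rle0 ?invr_gt0 // ltW // schwarzian_lt0.
(* A convex function lies above its tangent at [x], where [u] vanishes and has slope the square root
   of [F1 x]; squaring gives the claim. *)
have u_ge : g x * (y - x) <= (F y - F x) * phi y.
  have := @nondecreasing_of_derive R (fun t => (F t - F x) * phi t - g x * t)
    (fun t => g t - g x) x y (ltW xy).
  rewrite subrr mul0r sub0r => h.
  suff : - (g x * x) <= (F y - F x) * phi y - g x * y by lra.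
  apply: h => t /andP[xt ty].
    have td : a <= t <= d by apply: sub; rewrite xt.
    apply: is_derive_eq (is_derive_subr (du t td)
      (is_derive_mulr (is_derive_cst (g x : R) t 1) (is_derive_id t 1))) _.
    by rewrite mul0r add0r mulr1.
  by rewrite subr_ge0 g_le // !ltW.
have xad : a <= x <= d by rewrite sub // lexx ltW.
have yad : a <= y <= d by rewrite sub // lexx ltW.
have gx : g x = phi x * F1 x by rewrite /g subrr mul0r subr0.
have gx0 : 0 <= g x * (y - x).
  by rewrite gx !mulr_ge0 ?subr_ge0 ?ltW // ?phi0 ?F1_gt0.
have F1x := F1_gt0 xad; have F1y := F1_gt0 yad.
have := @lerXn2r _ 2 _ _ gx0 (le_trans gx0 u_ge) u_ge.
rewrite gx !exprMn !phi2 // => h.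
have := ler_wpM2r (ltW F1y) h; rewrite divfK ?lt0r_neq0 //.
apply: le_trans; rewrite le_eqVlt; apply/orP; left; apply/eqP.
by field; rewrite lt0r_neq0.
Qed.

(** By [derivative_product_le], the function [F1 x / (F y - F x) - 1 / (y - x)] has a nonnegative
    derivative in [y]. *)
Let difference_quotient_le x c : a <= x -> x < c -> c < d ->
  F1 x / (F c - F x) - (c - x)^-1 <= F1 x / (F d - F x) - (d - x)^-1.
Proof.
move=> ax xc cd.
have F1x : 0 < F1 x by rewrite F1_gt0 // ax /= ltW // (lt_trans xc).
apply: (@nondecreasing_of_derive R (fun y => F1 x / (F y - F x) - (y - x)^-1)
  (fun y => (y - x) ^- 2 - F1 x * F1 y / (F y - F x) ^+ 2) c d (ltW cd)) => y.
  move=> /andP[cy yd]; have xy := lt_le_trans xc cy.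
  have yad : a <= y <= d by rewrite yd (le_trans ax) ?ltW.
  have Fxy : F y - F x != 0 by rewrite lt0r_neq0 // subr_gt0 F_lt.
  have yx : y - x != 0 by rewrite lt0r_neq0 // subr_gt0.
  apply: is_derive_eq (is_derive_subr
    (is_derive_mulr (is_derive_cst (F1 x : R) y 1)
      (@is_derive_invr R (fun y => F y - F x) y _ Fxy (is_derive_subc (F x) (dF yad))))
    (@is_derive_invr R (fun y => y - x) y _ yx (is_derive_subc x (is_derive_id y 1)))) _.
  by rewrite /=; field; rewrite yx Fxy.
move=> /andP[cy yd]; have xy := lt_trans xc cy.
have Fxy : 0 < F y - F x by rewrite subr_gt0 F_lt // ltW.
rewrite subr_ge0 ler_pdivrMr ?exprn_gt0 // ler_pdivlMl ?exprn_gt0 ?subr_gt0 //.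
by rewrite mulrC derivative_product_le // ltW.
Qed.

(** For fixed [c] and [d], [h x] is the logarithm of the quotient of the mean slopes of [F] on
    [[x, c]] and on [[x, d]]; [difference_quotient_le] makes it nondecreasing in [x]. *)
Lemma cratio_schwarzian_le b c : a < b -> b < c -> c < d ->
  cratio (F a) (F b) (F c) (F d) <= cratio a b c d.
Proof.
move=> ab bc cd.
have Fab : F a < F b by rewrite F_lt // ltW // (lt_trans bc).
have Fbc : F b < F c by rewrite F_lt // ltW.
have Fcd : F c < F d by rewrite F_lt // ltW // (lt_trans ab).
pose h x := (ln (F c - F x) - ln (c - x)) - (ln (F d - F x) - ln (d - x)).
have : h a <= h b.
  apply: (@nondecreasing_of_derive R h (fun x =>
    (F1 x / (F d - F x) - (d - x)^-1) - (F1 x / (F c - F x) - (c - x)^-1))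
    a b (ltW ab)) => x.
    move=> /andP[ax xb]; have xc := le_lt_trans xb bc; have xd := lt_trans xc cd.
    have xad : a <= x <= d by rewrite ax ltW.
    have log_sub y : x < y -> y <= d -> is_derive x 1
        (fun x => ln (F y - F x) - ln (y - x)) (- F1 x / (F y - F x) - -1 / (y - x)).
      move=> xy yd; have Fxy : 0 < F y - F x by rewrite subr_gt0 F_lt.
      have yx : 0 < y - x by rewrite subr_gt0.
      exact: is_derive_subr
        (@is_derive_ln_comp R (fun x => F y - F x) x _ Fxy (is_derive_csub _ (dF xad)))
        (@is_derive_ln_comp R (fun x => y - x) x _ yx (is_derive_csub _ (is_derive_id x 1))).
    apply: is_derive_eq (is_derive_subr (log_sub c xc (ltW cd)) (log_sub d xd (lexx _))) _.
    by rewrite !mulNr !mul1r; ring.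
  move=> /andP[ax xb]; rewrite subr_ge0 difference_quotient_le //; first exact: ltW.
  exact: lt_trans bc.
have ac := lt_trans ab bc; have bd := lt_trans bc cd; have ad := lt_trans ac cd.
have Fac := lt_trans Fab Fbc; have Fbd := lt_trans Fbc Fcd.
have Fad := lt_trans Fac Fcd.
rewrite /h => hab.
(* With [T = [a, d]], this says that [|M||T| / (|L u M||M u R|)] does not decrease under [F]. Since
   [|L||R| + |M||T| = |L u M||M u R|], the cross-ratio [cratio] does not increase. *)
have : (F c - F a) * (d - a) * (c - b) * (F d - F b) <=
    (F c - F b) * (d - b) * (c - a) * (F d - F a).
  rewrite -ler_ln ?posrE ?mulr_gt0 ?subr_gt0 //.
  by rewrite !lnM ?posrE ?mulr_gt0 ?subr_gt0 //; lra.
rewrite -subr_ge0 => hPQ.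
rewrite /cratio ler_pdivrMr ?mulr_gt0 ?subr_gt0 // mulrAC.
rewrite ler_pdivlMr ?mulr_gt0 ?subr_gt0 // -subr_ge0.
by apply: le_trans hPQ _; rewrite le_eqVlt; apply/orP; left; apply/eqP; ring.
Qed.

End NegativeSchwarzian.

(** * Local distortion *)

Section LocalDistortion.
Context (R : realType) (F F1 F2 F3 : R -> R) (cs : seq R) (w : R).
Implicit Types (a b c d e x y : R) (k : int).
Hypothesis F_lt : {mono F : x y / x < y}.
Hypothesis F_per : forall x, F (x + 1) = F x + 1.
Hypothesis dF : forall x, is_derive x 1 F (F1 x).
Hypothesis dF1 : forall x, is_derive x 1 F1 (F2 x).
Hypothesis dF2 : forall x, is_derive x 1 F2 (F3 x).
Hypothesis critP : forall x, F1 x = 0 <-> exists2 e, e \in cs & exists k, x = e + k%:~R.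

Definition nonflat_near e w alpha beta s : Prop :=
  [/\ 0 < alpha, 0 < beta, 1 < s & forall x, 0 < `|x - e| < w ->
    [/\ F3 x / F1 x - 3 / 2 * (F2 x / F1 x) ^+ 2 < 0,
        alpha * `|x - e| `^ (s - 1) <= F1 x &
        F1 x <= beta * `|x - e| `^ (s - 1)]].

Hypothesis w01 : 0 < w < 1.
Hypothesis nonflat : forall e, e \in cs ->
  exists alpha beta s, nonflat_near e w alpha beta s.

Lemma derive_periodic (f f' : R -> R) (c : R) :
  (forall x, f (x + 1) = f x + c) -> (forall x, is_derive x 1 f (f' x)) ->
  forall x, f' (x + 1) = f' x.
Proof.
move=> per df x.
have h1 : is_derive x 1 (fun y => f (y + 1)) (f' (x + 1)).
  rewrite -[f' _]mulr1.
  exact: (@is_derive1_comp _ f (fun y => y + 1)) (is_derive_addc 1 (is_derive_id x 1)).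
have h2 : is_derive x 1 (fun y => f (y + 1)) (f' x).
  rewrite (_ : (fun y => _) = (fun y => f y + c)); first exact: is_derive_addc.
  by apply/funext => y; rewrite per.
by rewrite -(@derive_val _ _ _ _ _ _ _ h1) (@derive_val _ _ _ _ _ _ _ h2).
Qed.

Let F1_per x : F1 (x + 1) = F1 x. Proof. exact: derive_periodic F_per dF x. Qed.
Let F2_per x : F2 (x + 1) = F2 x.
Proof. by apply: (derive_periodic (c := 0)) dF1 x => y; rewrite F1_per addr0. Qed.

Let derive_continuous (f f' : R -> R) :
  (forall x, is_derive x 1 f (f' x)) -> continuous f.
Proof.
by move=> df x; apply/differentiable_continuous/derivable1_diffP; have [] := df x.
Qed.

Let F1_ge0 x : 0 <= F1 x.
Proof.
rewrite -[F1 x](@derive_val _ _ _ _ _ _ _ (dF x)) -derive1E.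
apply: (@incr_derive1_ge0 R F setT) => //.
- by move=> y z _ _; rewrite F_lt.
- by rewrite interiorT.
Qed.

Let F_addz x k : F (x + k%:~R) = F x + k%:~R.
Proof. exact: degree_one_addz. Qed.

Let F_le : {mono F : x y / x <= y}.
Proof. by apply: le_mono => x y; rewrite F_lt. Qed.

Let far x := forall e k, e \in cs -> w / 2 <= `|x - (e + k%:~R)|.

(** The points of [[0, 1]] far from all critical points form a compact set on which [F1] does not
    vanish; if it is empty, any bound will do. *)
Let F1_far_gt0 : exists2 m, 0 < m & forall x, far x -> m <= F1 x.
Proof.
pose A := `[0, 1]%classic `&`
  \bigcap_(p in [set p : R * int | p.1 \in cs])
    [set x : R | w / 2 <= `|x - (p.1 + p.2%:~R)|].
have far_floor x : far x -> A (x + (- Num.floor x)%:~R).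
  have /andP[h1 h2] := floor_itv x; rewrite rmorphD /= in h2.
  move=> fx; split; first by rewrite /= in_itv /= rmorphN /=; lra.
  move=> [e k] /= ecs; have := fx e (k + Num.floor x) ecs.
  rewrite !rmorphD rmorphN /= => h; apply: (le_trans h).
  by rewrite le_eqVlt; apply/orP; left; apply/eqP; congr `|_|; ring.
have [[x0 Ax0]|A0] := pselect (exists x, A x); last first.
  by exists 1 => // x /far_floor Ax; case: A0; exists (x + (- Num.floor x)%:~R).
have cA : compact A.
  apply: (subclosed_compact _ (@segment_compact _ 0 1)); last by move=> x [].
  apply: closedI; first exact: interval_closed.
  apply: closed_bigI => -[e k] /= _.
  apply: (@closed_comp _ _ (fun x => `|x - (e + k%:~R)|) [set y | w / 2 <= y]).
    move=> x _; apply: cvg_norm.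
    by apply: cvgB; [exact: cvg_id | exact: cvg_cst].
  exact: closed_ge.
have [z /set_mem Az zmin] := @compact_EVT_min _ R F1 A (ex_intro _ x0 Ax0) cA
  (continuous_subspaceT (derive_continuous dF1)).
exists (F1 z).
  rewrite lt0r F1_ge0 andbT; apply/eqP => /critP[e ecs [k ze]].
  by have [_ /(_ (e, k) ecs)] := Az; rewrite /= ze subrr normr0; case/andP: w01; lra.
move=> x /far_floor Ax; have := zmin _ (mem_set Ax).
by rewrite (periodic_intr F1_per).
Qed.

(** Triangle inequality: an interval shorter than [w / 2] that comes within [w / 2] of a critical
    point stays within [w] of it. *)
Let small_far_or_near a d : d - a < w / 2 ->
  (forall x, a <= x <= d -> far x) \/
  exists2 e, e \in cs & exists k, forall x, a <= x <= d -> `|x - (e + k%:~R)| < w.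
Proof.
move=> da.
have [[x [xad [e [k [ecs xe]]]]]|h] := pselect (exists x, a <= x <= d /\
    exists e k, e \in cs /\ `|x - (e + k%:~R)| < w / 2); [right|left].
  exists e => //; exists k => y /andP[ay yd]; case/andP: xad => ax xd.
  rewrite (_ : y - _ = (y - x) + (x - (e + k%:~R))); last by ring.
  rewrite (le_lt_trans (ler_normD _ _)) // [w]splitr ltr_leD // ?ltW //.
  by rewrite ltr_norml; lra.
move=> x xad e k ecs; rewrite leNgt; apply/negP => xe.
by apply: h; exists x; split=> //; exists e, k.
Qed.

(** Let [r] be the larger distance of an endpoint from [e]. Then [F1 x <= beta * r^(s - 1)], while
    on the quarter of [[a, b]] next to that endpoint the distance from [e] is at least [r / 2]; the
    increment of [F] over this quarter gives the constant. *)
Let near_sup_le e alpha beta s a b x : nonflat_near e w alpha beta s -> F1 e = 0 ->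
  `|a - e| < w -> `|b - e| < w -> a < b -> a <= x <= b ->
  F1 x * (b - a) <= 4 * 2 `^ (s - 1) * beta / alpha * (F b - F a).
Proof.
move=> [alpha0 beta0 s1 nf] F1e aw bw ab /andP[ax xb].
pose r := Num.max `|a - e| `|b - e|.
have rw : r < w by rewrite gt_max aw.
have ar : `|a - e| <= r by rewrite le_max lexx.
have br : `|b - e| <= r by rewrite le_max lexx orbT.
have r0 : 0 < r.
  rewrite ltNge; apply/negP => r0.
  by move: ar br ab; rewrite !ler_norml; lra.
have hr t : a <= t <= b -> `|t - e| <= r.
  by move=> /andP[h1 h2]; move: ar br; rewrite !ler_norml; lra.
have s10 : 0 <= s - 1 by rewrite subr_ge0 ltW.
pose l := (b - a) / 4.
have l0 : 0 < l by rewrite divr_gt0 // subr_gt0.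
have [t0 [at0 t0b ht0]] : exists t0, [/\ a <= t0, t0 + l <= b &
    forall t, t0 <= t <= t0 + l -> r / 2 <= `|t - e|].
  have [hab|hab] := leP `|a - e| `|b - e|.
    have re : r = `|b - e| by apply/max_idPr.
    have [be|be] := leP 0 (b - e).
      exists (b - l); rewrite (subrK l); split; rewrite /l; try lra.
      move=> t /andP[h1 h2]; rewrite re (ger0_norm be).
      rewrite ler_normr; apply/orP; left.
      by move: ar; rewrite re (ger0_norm be) ler_norml; lra.
    by exfalso; move: hab; rewrite (ltr0_norm be) ler_norml; lra.
  have re : r = `|a - e| by apply/max_idPl; exact: ltW.
  have [ae|ae] := leP 0 (a - e).
    by exfalso; move: hab; rewrite (ger0_norm ae) ltr_norml; lra.
  exists a; split; rewrite /l; try lra.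
  move=> t /andP[h1 h2]; rewrite re (ltr0_norm ae).
  rewrite ler_normr; apply/orP; right.
  by move: br; rewrite re (ltr0_norm ae) ler_norml; lra.
have [|xi /andP[xi1 xi2] xiE] := @mean_value R F F1 t0 (t0 + l) _ (fun x _ => dF x).
  by rewrite ltrDl.
rewrite (_ : t0 + l - t0 = l) in xiE; last by ring.
have r2 : 0 < r / 2 by rewrite divr_gt0.
have F1xi : alpha * (r / 2) `^ (s - 1) <= F1 xi.
  have xir : r / 2 <= `|xi - e| by rewrite ht0 // !ltW.
  have xie : 0 < `|xi - e| < w.
    rewrite (lt_le_trans r2 xir) (le_lt_trans _ rw) // hr //.
    by rewrite (le_trans at0) ?(le_trans _ t0b) ?ltW.
  have [_ + _] := nf xi xie; apply: le_trans; rewrite ler_pM2l //.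
  by rewrite ge0_ler_powR // nnegrE ltW // (lt_le_trans r2).
have F1x : F1 x <= beta * r `^ (s - 1).
  have [->|xe] := eqVneq x e.
    by rewrite F1e mulr_ge0 ?powR_ge0 // ltW.
  have xr : `|x - e| <= r by rewrite hr // ax.
  have xe' : 0 < `|x - e| < w by rewrite normr_gt0 subr_eq0 xe (le_lt_trans xr).
  have [_ _] := nf x xe'; move/le_trans; apply; rewrite ler_pM2l //.
  by rewrite ge0_ler_powR // nnegrE // ltW.
have FF : alpha * (r / 2) `^ (s - 1) * l <= F b - F a.
  apply: (@le_trans _ _ (F (t0 + l) - F t0)).
    by rewrite xiE ler_pM2r.
  by apply: lerB; rewrite F_le.
have C0 : 0 < 4 * 2 `^ (s - 1) * beta / alpha.
  by rewrite divr_gt0 // mulr_gt0 // mulr_gt0 // powR_gt0.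
apply: (@le_trans _ _ (4 * 2 `^ (s - 1) * beta / alpha *
    (alpha * (r / 2) `^ (s - 1) * l))); last by rewrite ler_pM2l.
have -> : 4 * 2 `^ (s - 1) * beta / alpha * (alpha * (r / 2) `^ (s - 1) * l) =
    beta * (2 `^ (s - 1) * (r / 2) `^ (s - 1)) * (b - a).
  by rewrite /l; field; rewrite lt0r_neq0.
rewrite -powRM // ?(ltW r2) // mulrC [2 * _]mulrC divfK // [leRHS]mulrC.
by rewrite ler_pM2l ?subr_gt0.
Qed.

(** Four kinds of intervals: shorter than [w / 2] and near a critical point, shorter than [w / 2]
    and far from all, of length between [w / 2] and [1], and longer. In the third case [F] increases
    at least by its minimal increment [kappa] over length [w / 2], in the last at least by the
    integer part of [b - a], thus by half of [b - a]. *)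
Lemma sup_derive_le : exists2 B, 0 < B & forall a b x, a < b -> a <= x <= b ->
  F1 x * (b - a) <= B * (F b - F a).
Proof.
have /andP[w0 w1] := w01.
have [M M0 F1M] := periodic_bounded F1_per (derive_continuous dF1).
have [m m0 F1m] := F1_far_gt0.
have cg : continuous (fun x => F (x + w / 2) - F x).
  apply: (derive_continuous (f' := fun x => F1 (x + w / 2) - F1 x)) => x.
  apply: is_derive_subr => //.
  rewrite -[F1 _]mulr1.
  exact: (@is_derive1_comp _ F (fun y => y + w / 2)) (is_derive_addc _ (is_derive_id x 1)).
have [|z zmin] := periodic_min _ cg.
  by move=> x; rewrite addrAC !F_per; ring.
set kappa := F (z + w / 2) - F z in zmin.
have kappa0 : 0 < kappa by rewrite subr_gt0 F_lt ltrDl divr_gt0.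
have [||B B0 hB] := @uniform_bound R _ cs (fun e B => forall a b x,
    `|a - e| < w -> `|b - e| < w -> a < b -> a <= x <= b ->
    F1 x * (b - a) <= B * (F b - F a)).
- move=> e r r' rr' h a b x h1 h2 ab h4; apply: (le_trans (h a b x h1 h2 ab h4)).
  by rewrite ler_pM2r // subr_gt0 F_lt.
- move=> e ecs; have [alpha [beta [s nf]]] := nonflat ecs.
  exists (4 * 2 `^ (s - 1) * beta / alpha) => a b x h1 h2 h3 h4.
  apply: near_sup_le nf _ h1 h2 h3 h4.
  by apply/critP; exists e => //; exists 0; rewrite addr0.
have F1x0 x : F1 x <= M by apply: le_trans (ler_norm _) (F1M x).
exists (Num.max B (Num.max (M / m) (Num.max (M / kappa) (2 * M)))); first by rewrite lt_max B0.
move=> a b x ab xab; have Fab : 0 < F b - F a by rewrite subr_gt0 F_lt.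
have ba : 0 < b - a by rewrite subr_gt0.
suff [h|[h|[h|h]]] : F1 x * (b - a) <= B * (F b - F a) \/
   F1 x * (b - a) <= M / m * (F b - F a) \/
   F1 x * (b - a) <= M / kappa * (F b - F a) \/
   F1 x * (b - a) <= 2 * M * (F b - F a);
  try by apply: (le_trans h); rewrite ler_pM2r // !le_max lexx ?orbT.
have upM c : b - a <= c -> M * (b - a) <= M * c by rewrite ler_pM2l.
have F1Mba : F1 x * (b - a) <= M * (b - a) by rewrite ler_pM2r.
have [sm|la] := ltP (b - a) (w / 2).
  case: (small_far_or_near sm) => [fr|[e ecs [k nr]]].
    right; left; apply: (le_trans F1Mba); rewrite -mulrA ler_pM2l //.
    rewrite mulrC ler_pdivlMr // mulrC.
    have [xi /andP[xi1 xi2] ->] := @mean_value R F F1 a b ab (fun x _ => dF x).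
    by rewrite ler_pM2r // F1m //; apply: fr; rewrite !ltW.
  left; have := hB e ecs (a - k%:~R) (b - k%:~R) (x - k%:~R).
  rewrite -!rmorphN !F_addz (periodic_intr F1_per) rmorphN /=.
  have shift y : y - k%:~R - e = y - (e + k%:~R) by ring.
  have aab : a <= a <= b by rewrite lexx ltW.
  have bab : a <= b <= b by rewrite lexx ltW.
  rewrite !shift (nr a aab) (nr b bab) => /(_ isT isT).
  rewrite ltrD2r !lerD2r ab xab => /(_ isT isT).
  rewrite (_ : b + _ - _ = b - a); last by ring.
  by rewrite (_ : F b + _ - _ = F b - F a); last by ring.
have [ba1|/ltW ba1] := leP (b - a) 1.
  right; right; left; apply: (le_trans F1Mba); rewrite -mulrA ler_pM2l //.
  rewrite (le_trans ba1) // ler_pdivlMl // mulr1 (le_trans (zmin a)) //.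
  by rewrite lerD2r F_le -lerBrDl.
right; right; right; apply: (le_trans F1Mba); rewrite mulrC mulrAC ler_pM2r //.
have /andP[n1 n2] := floor_itv (b - a); rewrite rmorphD /= in n2.
have n0 : 1 <= (Num.floor (b - a))%:~R :> R.
  by rewrite -[1]/(1%:~R) ler_int floor_ge_int.
have : F (a + (Num.floor (b - a))%:~R) <= F b by rewrite F_le -lerBrDl.
by rewrite F_addz; lra.
Qed.

Let cratio_sq_le D a b c d : 0 <= D -> a < b -> b < c -> c < d ->
  (F b - F a) * (c - a) <= D * (b - a) * (F c - F a) ->
  (F d - F c) * (d - b) <= D * (d - c) * (F d - F b) ->
  cratio (F a) (F b) (F c) (F d) <= D ^+ 2 * cratio a b c d.
Proof.
move=> D0 ab bc cd h1 h2.
have ac := lt_trans ab bc; have bd := lt_trans bc cd.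
have split_cr (x y z t : R) : cratio x y z t = ((y - x) / (z - x)) * ((t - z) / (t - y)).
  by rewrite /cratio invfM mulrACA.
have quot (x y u v : R) : 0 < y -> 0 < v -> x * v <= D * u * y -> x / y <= D * (u / v).
  by move=> y0 v0 h; rewrite ler_pdivrMr // mulrA mulrAC ler_pdivlMr.
have pos (x y z t : R) : x <= y -> z <= t -> 0 <= (y - x) / (t - z).
  by move=> xy zt; rewrite divr_ge0 // subr_ge0.
rewrite !split_cr expr2 [leRHS]mulrACA; apply: ler_pM.
- by apply: pos; rewrite F_le ltW.
- by apply: pos; rewrite F_le ltW.
- by apply: quot; rewrite ?subr_gt0 ?F_lt.
- by apply: quot; rewrite ?subr_gt0 ?F_lt.
Qed.

(** The mean value theorem integrates the bounds on [F1]. For [t >= w / 2] the upper bound comes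
    from [F1 <= M], since [t^s] is then bounded below. *)
Lemma smooth_power_law e : e \in cs -> exists alpha beta s, power_law F e alpha beta s.
Proof.
move=> ecs; have [alpha [beta [s [alpha0 beta0 s1 nf]]]] := nonflat ecs.
have /andP[w0 w1] := w01.
have [M M0 F1M] := periodic_bounded F1_per (derive_continuous dF1).
have F1x0 x : F1 x <= M by apply: le_trans (ler_norm _) (F1M x).
have s0 : 0 <= s by lra.
have s10 : 0 <= s - 1 by lra.
have w2 : 0 < w / 2 by rewrite divr_gt0.
have w4 : 0 < w / 4 by rewrite divr_gt0.
have ws0 : 0 < (w / 2) `^ s by exact: powR_gt0.
have ws4 : 0 < (w / 4) `^ s by exact: powR_gt0.
exists (alpha * (w / 4) `^ s), (Num.max beta (M / (w / 2) `^ s)), s.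
split; rewrite ?mulr_gt0 ?lt_max ?beta0 // => t /andP[t0 t1].
have ts0 : 0 < t `^ s by exact: powR_gt0.
have pow1 y : 0 < y -> y * y `^ (s - 1) = y `^ s.
  by move=> y0; rewrite mulr_powRB1 //; lra.
have lower u v r : u < v -> 0 < r -> r < w / 2 -> v - u = r ->
    (forall x, u < x < v -> r <= `|x - e| <= 2 * r) -> alpha * r `^ s <= F v - F u.
  move=> uv r0 rw uvr hx.
  have [xi xi1 ->] := @mean_value R F F1 u v uv (fun x _ => dF x).
  have /andP[x1 x2] := hx xi xi1.
  have [|_ h _] := nf xi; first by rewrite (lt_le_trans r0 x1) (le_lt_trans x2) //; lra.
  rewrite uvr -pow1 // mulrCA mulrC ler_pM2r //; apply: le_trans h.
  by rewrite ler_pM2l // ge0_ler_powR // nnegrE ltW // (lt_le_trans r0).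
have upper u v : u < v -> v - u = t -> t < w / 2 ->
    (forall x, u < x < v -> 0 < `|x - e| <= t) -> F v - F u <= beta * t `^ s.
  move=> uv uvt tw hx.
  have [xi xi1 ->] := @mean_value R F F1 u v uv (fun x _ => dF x).
  have /andP[x1 x2] := hx xi xi1.
  have [|_ _ h] := nf xi; first by rewrite x1 (le_lt_trans x2) //; lra.
  rewrite uvt -pow1 // mulrCA [leRHS]mulrC ler_pM2r //; apply: (le_trans h).
  by rewrite ler_pM2l // ge0_ler_powR // nnegrE ltW.
have crude u v : u < v -> v - u = t -> F v - F u <= M * t.
  move=> uv uvt.
  have [xi xi1 ->] := @mean_value R F F1 u v uv (fun x _ => dF x).
  by rewrite uvt ler_pM2r.
have powle y : 0 < y -> w / 4 * t <= y -> (w / 4) `^ s * t `^ s <= y `^ s.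
  move=> y0 yt; rewrite -powRM ?(ltW w4) ?(ltW t0) // ge0_ler_powR // nnegrE ltW //.
  exact: mulr_gt0.
have upper' x : (t < w / 2 -> x <= beta * t `^ s) -> x <= M * t ->
    x <= Num.max beta (M / (w / 2) `^ s) * t `^ s.
  move=> h1 h2; have [/h1 h|tw] := ltP t (w / 2).
    by apply: (le_trans h); rewrite ler_pM2r // le_max lexx.
  apply: (le_trans h2); apply: (@le_trans _ _ (M / (w / 2) `^ s * t `^ s)); last first.
    by rewrite ler_pM2r // le_max lexx orbT.
  rewrite -mulrA ler_pM2l // mulrC ler_pdivlMr //.
  apply: (@le_trans _ _ (1 * (w / 2) `^ s)); first by rewrite ler_pM2r.
  by rewrite mul1r ge0_ler_powR // nnegrE ltW.
(* For the lower bound only the part at distance between [r] and [2 r] from [e] is kept. It lies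
   inside the neighbourhood because [r <= w / 4], and [r >= (w / 4) t] because [w] and [t] are at
   most [1]. *)
pose r := Num.min (t / 2) (w / 4).
have r0 : 0 < r by rewrite lt_min divr_gt0.
have rt : r <= t / 2 by rewrite ge_min lexx.
have rw : r <= w / 4 by rewrite ge_min lexx orbT.
have rlow : alpha * (w / 4) `^ s * t `^ s <= alpha * r `^ s.
  rewrite -mulrA ler_pM2l //; apply: powle => //.
  rewrite le_min; apply/andP; split; last by rewrite ger_pMr.
  by rewrite mulrC ler_pM2l //; lra.
split; apply/andP; split.
- apply: (le_trans rlow); apply: (@le_trans _ _ (F (e + 2 * r) - F (e + r))).
    apply: lower => //; [lra|lra|by ring|move=> x xr].
    by rewrite ger0_norm; lra.
  by apply: lerB; rewrite F_le; lra.
- apply: upper' => [tw|].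
    apply: upper => //; [lra|by ring|move=> x xr].
    by rewrite gtr0_norm; lra.
  by apply: crude; [lra|ring].
- apply: (le_trans rlow); apply: (@le_trans _ _ (F (e - r) - F (e - 2 * r))).
    apply: lower => //; [lra|lra|by ring|move=> x xr].
    by rewrite ler0_norm; lra.
  by apply: lerB; rewrite F_le; lra.
- apply: upper' => [tw|].
    apply: upper => //; [lra|by ring|move=> x xr].
    by rewrite ltr0_norm; lra.
  by apply: crude; [lra|ring].
Qed.

Lemma cratio_shift (t a b c d : R) : cratio (a + t) (b + t) (c + t) (d + t) = cratio a b c d.
Proof. by rewrite /cratio; congr (_ / _); ring. Qed.

Let cratio_far C a b c d : 0 <= C -> a < b -> b < c -> c < d ->
  (forall x y, a <= x <= d -> a <= y <= d -> F1 x <= (1 + C) * F1 y) ->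
  cratio (F a) (F b) (F c) (F d) <= (1 + C) ^+ 2 * cratio a b c d.
Proof.
move=> C0 ab bc cd hC; have C1 : 0 <= 1 + C by rewrite addr_ge0.
have ac := lt_trans ab bc; have bd := lt_trans bc cd.
have main x y u v : a <= x -> x < y -> y <= d -> a <= u -> u < v -> v <= d ->
    (F y - F x) * (v - u) <= (1 + C) * (y - x) * (F v - F u).
  move=> ax xy yd au uv vd.
  have [xi /andP[h1 h2] ->] := @mean_value R F F1 x y xy (fun x _ => dF x).
  have [xj /andP[h3 h4] ->] := @mean_value R F F1 u v uv (fun x _ => dF x).
  rewrite mulrA [(1 + C) * _ * _]mulrAC ler_pM2r ?subr_gt0 //.
  rewrite ler_pM2r ?subr_gt0 // hC //.
    by rewrite (le_trans ax) ?(le_trans _ yd) ?ltW.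
  by rewrite (le_trans au) ?(le_trans _ vd) ?ltW.
by apply: cratio_sq_le => //; apply: main => //; rewrite ltW.
Qed.

(** The crude factor [B^2] serves for arbitrary and for long intervals. On short ones far from the
    critical points [F1] varies by a factor [1 + O(d - a)]; on short ones near a critical point, but
    not containing it, the negative Schwarzian derivative gives the factor [1]. *)
Lemma smooth_cratio_distortion : exists A, cratio_distortion F cs A.
Proof.
have /andP[w0 w1] := w01; have w2 : 0 < w / 2 by rewrite divr_gt0.
have [B B0 hB] := sup_derive_le.
have [M M0 F2M] := periodic_bounded F2_per (derive_continuous dF2).
have [m m0 F1m] := F1_far_gt0.
have C0 : 0 < M / m by rewrite divr_gt0.
have lip x y : x <= y -> `|F1 y - F1 x| <= M * (y - x).
  rewrite le_eqVlt => /predU1P[->|xy]; first by rewrite !subrr normr0 mulr0.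
  have [xi _ ->] := @mean_value R F1 F2 x y xy (fun x _ => dF1 x).
  by rewrite normrM (gtr0_norm (_ : 0 < y - x)) ?ler_pM2r ?subr_gt0.
have B2 : 0 < B ^+ 2 by rewrite exprn_gt0.
(* One term for each use: long intervals free of critical points, arbitrary intervals, short
   intervals far from the critical points. *)
pose A := B ^+ 2 / (w / 2) + B ^+ 2 + 2 * (M / m).
have A0 : 0 < A by rewrite !addr_gt0 // ?divr_gt0 // mulr_gt0.
have crude a b c d : a < b -> b < c -> c < d ->
    cratio (F a) (F b) (F c) (F d) <= B ^+ 2 * cratio a b c d.
  move=> ab bc cd; have ac := lt_trans ab bc; have bd := lt_trans bc cd.
  have main x y u v : u <= x -> x < y -> y <= v ->
      (F y - F x) * (v - u) <= B * (y - x) * (F v - F u).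
    move=> ux xy yv; have uv : u < v by rewrite (le_lt_trans ux) // (lt_le_trans xy).
    have [xi /andP[h1 h2] ->] := @mean_value R F F1 x y xy (fun x _ => dF x).
    rewrite mulrAC [leRHS]mulrAC ler_pM2r ?subr_gt0 // hB //.
    by rewrite (le_trans ux) ?(le_trans _ yv) ?ltW.
  by apply: cratio_sq_le; rewrite ?(ltW B0) //; apply: main; rewrite ?lexx // ltW.
have exp_ge x y : x <= y -> x <= expR y.
  by move=> xy; rewrite (le_trans _ (expR_ge1Dx y)) // (le_trans xy) // ler_wpDl.
have exp_ge' y : 0 <= y -> 1 <= expR y.
  by move=> y0; rewrite (le_trans _ (expR_ge1Dx y)) // lerDl.
have cr0 a b c d : a < b -> b < c -> c < d -> 0 <= cratio a b c d.
  by move=> ab bc cd; rewrite ltW // cratio_gt0.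
exists A; split=> [|a b c d ab bc cd|a b c d ab bc cd hits]; first exact: ltW.
  rewrite (le_trans (crude _ _ _ _ ab bc cd)) // ler_wpM2r ?cr0 // exp_ge //.
  have h1 : 0 < B ^+ 2 / (w / 2) by rewrite divr_gt0.
  by rewrite /A; lra.
have ad : a < d by apply: lt_trans ab (lt_trans bc cd).
have da : 0 < d - a by rewrite subr_gt0.
have [sm|la] := ltP (d - a) (w / 2); last first.
  rewrite (le_trans (crude _ _ _ _ ab bc cd)) // ler_wpM2r ?cr0 // exp_ge //.
  apply: (@le_trans _ _ (B ^+ 2 / (w / 2) * (d - a))).
    by rewrite -[leLHS](divfK (lt0r_neq0 w2)) ler_pM2l // divr_gt0.
  rewrite ler_pM2r // /A -addrA ler_wpDr // addr_ge0 ?(ltW B2) //.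
  by rewrite mulr_ge0 // ltW.
case: (small_far_or_near sm) => [fr|[e ecs [k nr]]].
  have C1 : 0 <= M / m * (d - a) by rewrite mulr_ge0 // ltW.
  apply: (le_trans (cratio_far C1 ab bc cd _)) => [x y xad yad|].
    have F1y : m <= F1 y by apply: F1m; exact: fr.
    have dxy : F1 x - F1 y <= M * (d - a).
      move: xad yad => /andP[ax xd] /andP[ay yd]; have [/lip h|/ltW/lip h] := leP x y.
        rewrite distrC in h; apply: le_trans (ler_norm _) (le_trans h _).
        by rewrite ler_pM2l // lerB.
      apply: le_trans (ler_norm _) (le_trans h _).
      by rewrite ler_pM2l // lerB.
    rewrite mulrDl mul1r -lerBlDl (le_trans dxy) //.
    have -> : M / m * (d - a) * F1 y = M * (d - a) * (F1 y / m) by ring.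
    by rewrite ler_peMr ?mulr_ge0 ?(ltW M0) ?(ltW da) // ler_pdivlMr // mul1r.
  rewrite ler_wpM2r ?cr0 // (@le_trans _ _ (expR (M / m * (d - a)) ^+ 2)) //.
    by rewrite lerXn2r ?nnegrE ?addr_ge0 ?expR_ge0 ?expR_ge1Dx.
  rewrite -expRM_natl ler_expR mulrA ler_pM2r // /A.
  have h1 : 0 < B ^+ 2 / (w / 2) by rewrite divr_gt0.
  by lra.
have Fk x : F (x + (- k)%:~R) = F x + (- k)%:~R by exact: F_addz.
have kE : (- k)%:~R = - k%:~R :> R by rewrite rmorphN.
(* [hits] excludes [x = e], so the translated interval lies in the punctured neighbourhood of
   [e]. *)
have near x : a + (- k)%:~R <= x <= d + (- k)%:~R -> 0 < `|x - e| < w.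
  rewrite kE => /andP[h1 h2]; have xk : a <= x + k%:~R <= d by apply/andP; split; lra.
  have := nr _ xk; rewrite opprD addrA addrAC addrK => ->; rewrite andbT.
  rewrite normr_gt0 subr_eq0; apply/eqP => xe.
  by have := hits e k ecs; rewrite -xe xk.
have [al [be [s [_ _ _ nf]]]] := nonflat ecs.
have := @cratio_schwarzian_le R F F1 F2 F3 (a + (- k)%:~R) (d + (- k)%:~R)
  (fun x _ => dF x) (fun x _ => dF1 x) (fun x _ => dF2 x).
move=> /(_ _ _ (b + (- k)%:~R) (c + (- k)%:~R)).
rewrite !ltrD2r !Fk !cratio_shift => sch.
rewrite -[leLHS]mul1r; apply: ler_pM => //; first by rewrite cr0 // F_lt.
  by rewrite exp_ge' // mulr_ge0 // ltW.
apply: sch => // x xad; last by have [] := nf x (near x xad).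
rewrite lt0r F1_ge0 andbT; apply/eqP => /critP[e' e'cs [k' xe]].
have := hits e' (k' + k) e'cs; rewrite rmorphD /= addrA -xe.
by move: xad; rewrite kE => /andP[h1 h2] /negP; apply; apply/andP; split; lra.
Qed.

End LocalDistortion.

(** * Continued fractions *)

Section ContinuedFractionReturns.
Context (R : realType) (rho : R).
Implicit Types (n a : nat) (k : int).
Hypothesis rho01 : 0 < rho < 1.
Hypothesis irrational : forall a k, (0 < a)%N -> a%:R * rho + k%:~R != 0.

(** Numerators of the convergents, indexed like [cf_denom]: [p_0 / q_0 = 0 / 1] and
    [p_1 / q_1 = 1 / a_0]. *)
Fixpoint cf_num (rho : R) (n : nat) : nat :=
  match n with
  | 0 => 0
  | n1.+1 => match n1 with
             | 0 => 1
             | n2.+1 => cf_coef rho n1 * cf_num rho n1 + cf_num rho n2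
             end
  end%N.

Local Notation q := (cf_denom rho).
Local Notation p := (cf_num rho).

Let g n : R := iter n (fun x => fracpart x^-1) rho.
Let theta n : R := (q n)%:R * rho - (p n)%:R.

Let cf_denomSS n : q n.+2 = (cf_coef rho n.+1 * q n.+1 + q n)%N. Proof. by []. Qed.
Let cf_numSS n : p n.+2 = (cf_coef rho n.+1 * p n.+1 + p n)%N. Proof. by []. Qed.

Lemma fracpart_itv (x : R) : 0 <= fracpart x < 1.
Proof.
have /andP[h1 h2] := floor_itv x; rewrite rmorphD /= in h2.
by rewrite /fracpart; lra.
Qed.

Let g_itv n : 0 <= g n < 1.
Proof.
case: n => [|n]; last exact: fracpart_itv.
by case/andP: rho01 => h1 h2; rewrite /g /= ltW.
Qed.

Let gS n : 0 < g n -> (cf_coef rho n)%:R = (g n)^-1 - g n.+1.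
Proof.
move=> g0; rewrite /g /= -/(g n) /fracpart subKr /cf_coef -/(g n).
have gi : 0 <= (g n)^-1 by rewrite invr_ge0 ltW.
by rewrite truncn_floor gi natr_absz ger0_norm // floor_ge0.
Qed.

Let cf_coef_gt0 n : 0 < g n -> (0 < cf_coef rho n)%N.
Proof.
move=> g0; have /andP[_ g1] := g_itv n.
by rewrite /cf_coef -/(g n) truncn_gt0 ltW // invf_gt1.
Qed.

Let theta_neq0 n : (0 < q n)%N -> theta n != 0.
Proof. by move=> qn; have := irrational (- (p n)%:Z) qn; rewrite rmorphN. Qed.

(** The Gauss orbit [g] gives the ratios of consecutive displacements. Irrationality makes
    [theta n.+1] nonzero, hence [g n.+1] positive, so the orbit never stops. *)
Let recurrence n : [/\ 0 < g n, (0 < q n <= q n.+1)%N & theta n.+1 = - theta n * g n.+1].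
Proof.
elim: n => [|n [g0 /andP[qn qSn] th]].
  have /andP[r0 _] := rho01; have g0 : 0 < g 0 by [].
  split=> //=; first by rewrite cf_coef_gt0.
  rewrite /theta /= gS // subr0 mul1r mulrBl mulVf ?lt0r_neq0 //.
  by rewrite mulrC /g /=; ring.
have qSn0 := leq_trans qn qSn.
have gS0 : 0 < g n.+1.
  have := theta_neq0 qSn0; rewrite th mulf_eq0 negb_or => /andP[_ gn].
  by rewrite lt0r gn; case/andP: (g_itv n.+1).
split=> //.
  by rewrite qSn0 cf_denomSS (leq_trans _ (leq_addr _ _)) // leq_pmull // cf_coef_gt0.
have : theta n.+2 = (cf_coef rho n.+1)%:R * theta n.+1 + theta n.
  by rewrite /theta cf_denomSS cf_numSS !natrD !natrM; ring.
by rewrite gS // => ->; rewrite mulrBl {1}th; field; rewrite lt0r_neq0.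
Qed.

Lemma cf_denom_gt0 n : (0 < q n)%N. Proof. by have [_ /andP[]] := recurrence n. Qed.

Lemma cf_theta_step n :
  theta n.+2 = (cf_coef rho n.+1)%:R * theta n.+1 + theta n.
Proof. by rewrite /theta cf_denomSS cf_numSS !natrD !natrM; ring. Qed.

Let theta_sign n : exists D, [/\ theta n = (-1) ^+ n * D, 0 < D < 1 &
  exists D', [/\ theta n.+1 = - (-1) ^+ n * D', 0 < D' & D' < D]].
Proof.
have step m D : 0 < D -> theta m = (-1) ^+ m * D -> exists D',
    [/\ theta m.+1 = - (-1) ^+ m * D', 0 < D' & D' < D].
  move=> D0 th; have [_ _ ->] := recurrence m; exists (D * g m.+1).
  have [g0 _ _] := recurrence m.+1; have /andP[_ g1] := g_itv m.+1.
  by rewrite th mulr_gt0 // gtr_pMr //; split=> //; ring.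
suff [D [h1 h2]] : exists D, theta n = (-1) ^+ n * D /\ 0 < D < 1.
  by exists D; split=> //; apply: step => //; case/andP: h2.
elim: n => [|n [D [th /andP[D0 D1]]]].
  by exists rho; split=> //; rewrite /theta /=; ring.
have [D' [h1 h2 h3]] := step n D D0 th; exists D'.
by rewrite h1 exprS mulN1r h2 (lt_trans h3).
Qed.

(** Only invertibility over the integers matters below, so the sign is left unspecified. *)
Let determinant n : exists b : bool,
  (q n)%:Z * (p n.+1)%:Z - (q n.+1)%:Z * (p n)%:Z = (-1) ^+ b.
Proof.
elim: n => [|n [b h]]; first by exists false => /=; rewrite mulr0 subr0.
exists (~~ b); rewrite signrN -h cf_denomSS cf_numSS !PoszD !PoszM; ring.
Qed.

(** By [determinant], [(a, - k)] is an integral combination [u (q_n, p_n) + v (q_{n+1}, p_{n+1})].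
    Since [0 < a < q_{n+1}], either [v = 0] or [u] and [v] have opposite signs; the displacements
    alternate in sign, so their contributions add up. *)
Let best_approximation n a k : (0 < a < q n.+1)%N ->
  `|theta n| <= `|a%:R * rho + k%:~R|.
Proof.
move=> /andP[a0 aq]; have [b det] := determinant n.
pose u := (-1) ^+ b * (a%:Z * (p n.+1)%:Z + k * (q n.+1)%:Z).
pose v := - (-1) ^+ b * (a%:Z * (p n)%:Z + k * (q n)%:Z).
have sb : (-1) ^+ b * (-1) ^+ b = 1 :> int by rewrite -signr_addb addbb.
have aE : a%:Z = u * (q n)%:Z + v * (q n.+1)%:Z.
  have -> : u * (q n)%:Z + v * (q n.+1)%:Z = (-1) ^+ b * a%:Z *
    ((q n)%:Z * (p n.+1)%:Z - (q n.+1)%:Z * (p n)%:Z) by rewrite /u /v; ring.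
  by rewrite det mulrAC sb mul1r.
have kE : k = - (u * (p n)%:Z + v * (p n.+1)%:Z).
  have -> : - (u * (p n)%:Z + v * (p n.+1)%:Z) = (-1) ^+ b * k *
    ((q n)%:Z * (p n.+1)%:Z - (q n.+1)%:Z * (p n)%:Z) by rewrite /u /v; ring.
  by rewrite det mulrAC sb mul1r.
have E : a%:R * rho + k%:~R = u%:~R * theta n + v%:~R * theta n.+1.
  have -> : a%:R = (a%:Z)%:~R :> R by [].
  rewrite {1}aE {1}kE rmorphN !rmorphD !rmorphM /= /theta -!pmulrn; ring.
have qn := cf_denom_gt0 n.
have uv : (v = 0 /\ u <> 0) \/ (1 <= v /\ u <= -1) \/ (v <= -1 /\ 1 <= u).
  have gen (x y : int) (q0 q1 : nat) : a%:Z = x * q0%:Z + y * q1%:Z ->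
      (0 < a)%N -> (a < q1)%N -> (0 < q0)%N ->
      (y = 0 /\ x <> 0) \/ (1 <= y /\ x <= -1) \/ (y <= -1 /\ 1 <= x).
    move=> e a0' aq1 q00; have [y0|[y1|y1]] : y = 0 \/ 1 <= y \/ y <= -1 by lia.
    - by left; split=> // x0; move: e; rewrite y0 x0 !mul0r; lia.
    - right; left; split=> //; have h : q1%:Z <= y * q1%:Z by rewrite ler_peMl.
      have [//|x0] : x <= -1 \/ 0 <= x by lia.
      have : 0 <= x * q0%:Z by rewrite mulr_ge0.
      by lia.
    right; right; split=> //; have h : q1%:Z <= - y * q1%:Z by rewrite ler_peMl //; lia.
    have [//|x0] : 1 <= x \/ x <= 0 by lia.
    have : x * q0%:Z <= 0 by rewrite mulr_le0_ge0.
    by lia.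
  exact: gen aE a0 aq qn.
have [D [thn /andP[D0 _] [D' [thSn D'0 D'D]]]] := theta_sign n.
have -> : a%:R * rho + k%:~R = (-1) ^+ n * (u%:~R * D - v%:~R * D').
  by rewrite E thn thSn; ring.
rewrite thn !normrM !normrX !normrN1 expr1n !mul1r gtr0_norm //.
have [[-> u0]|[[v1 u1]|[v1 u1]]] := uv.
- rewrite mul0r subr0 normrM (gtr0_norm D0) ler_peMl ?(ltW D0) //.
  by rewrite -intr_norm -[1]/(1%:~R) ler_int; lia.
- have h1 : v%:~R >= 1%:~R :> R by rewrite ler_int.
  have h2 : u%:~R <= (-1)%:~R :> R by rewrite ler_int.
  have h3 : 0 <= v%:~R * D' by rewrite mulr_ge0 ?ltW //; lra.
  have h4 : D <= - u%:~R * D by rewrite ler_peMl ?(ltW D0) //; lra.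
  by rewrite ler_normr; apply/orP; right; lra.
- have h1 : u%:~R >= 1%:~R :> R by rewrite ler_int.
  have h2 : v%:~R <= (-1)%:~R :> R by rewrite ler_int.
  have h3 : 0 <= - v%:~R * D' by rewrite mulr_ge0 ?ltW //; lra.
  have h4 : D <= u%:~R * D by rewrite ler_peMl ?(ltW D0) //; lra.
  by rewrite ler_normr; apply/orP; left; lra.
Qed.

(** Multiplication by [(-1)^n] brings both parities to the case where the first return moves to the
    right. *)
Lemma cf_returns n : consecutive_returns ((-1) ^+ n * rho)
  (q n) (- ((-1) ^+ n * (p n)%:Z)) (q n.+1) (- ((-1) ^+ n * (p n.+1)%:Z)).
Proof.
have [D [thn /andP[D0 D1] [D' [thSn D'0 D'D]]]] := theta_sign n.
have ss : (-1) ^+ n * (-1) ^+ n = 1 :> R by rewrite -expr2 sqrr_sign.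
have castE m : (q m)%:R * ((-1) ^+ n * rho) + (- ((-1) ^+ n * (p m)%:Z))%:~R =
    (-1) ^+ n * theta m.
  by rewrite rmorphN rmorphM rmorphXn /= rmorphN /= /theta -pmulrn; ring.
have tE : (-1) ^+ n * theta n = D by rewrite thn mulrA ss mul1r.
have tE' : (-1) ^+ n * theta n.+1 = - D'.
  by rewrite thSn mulrA mulrN ss mulN1r.
split; rewrite ?castE ?tE ?tE'.
- by case: (recurrence n).
- by rewrite D0.
- by rewrite oppr_lt0.
- by rewrite subr_gt0.
- move=> a k aq; have := best_approximation ((-1) ^+ n * k) aq.
  rewrite thn normrM normrX normrN1 expr1n mul1r gtr0_norm // => h.
  apply: (le_trans h); rewrite -[leLHS]mul1r -{1}(expr1n _ n) -{1}(normrN1 R).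
  rewrite -normrX -normrM mulrDr le_eqVlt; apply/orP; left; apply/eqP.
  congr `|_ + _|; first by ring.
  by rewrite rmorphM rmorphXn rmorphN /= mulrA ss mul1r.
Qed.

Lemma cf_oriented_returns n :
  oriented_returns rho (q n) (- (p n)%:Z) (q n.+1) (- (p n.+1)%:Z).
Proof.
have := cf_returns n; rewrite -(signr_odd R n) -(signr_odd int n).
case: (odd n); last by rewrite !expr0 !mul1r; left.
by rewrite !expr1 !mulN1r => h; right.
Qed.

End ContinuedFractionReturns.

(** * Rotation numbers *)

Section RotationNumber.
Context (R : realType) (F : R -> R).
Implicit Types (x y : R) (a n m : nat) (k : int).
Hypothesis F_le : {mono F : x y / x <= y}.
Hypothesis F_per : forall x, F (x + 1) = F x + 1.
Hypothesis F_cont : continuous F.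
Hypothesis F_surj : forall y, exists x, F x = y.
Hypothesis aperiodic : forall x a k, (0 < a)%N -> iter a F x != x + k%:~R.

Let u n : R := iter n F 0.

Let iterF_addz a x k : iter a F (x + k%:~R) = iter a F x + k%:~R.
Proof. exact: iter_addz (degree_one_addz F_per) _ _ _. Qed.

Let iterF_le a : {mono iter a F : x y / x <= y}. Proof. exact: iter_le_mono. Qed.

Let u_add m n : u m + u n - 1 <= u (m + n) <= u m + u n + 1.
Proof.
have /andP[h1 h2] := floor_itv (u n); rewrite rmorphD /= in h2.
rewrite /u iterD -/(u n).
have : iter m F (0 + (Num.floor (u n))%:~R) <= iter m F (u n).
  by rewrite iterF_le add0r.
have : iter m F (u n) <= iter m F (0 + (Num.floor (u n) + 1)%:~R).
  by rewrite iterF_le add0r rmorphD /= ltW.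
by rewrite !iterF_addz rmorphD /= -/(u m); lra.
Qed.

Let u_mul m n : (0 < n)%N ->
  n%:R * (u m - 1) <= u (n * m) - 1 /\ u (n * m) + 1 <= n%:R * (u m + 1).
Proof.
case: n => // n _; elim: n => [|n [h1 h2]]; first by rewrite mul1n !mul1r.
have := u_add (n.+1 * m) m; rewrite addnC -mulSn -[n.+2]addn1 natrD.
by lra.
Qed.

(** Estimating [u (n * m)] in two ways shows that every [(u m - 1) / m] is at most every
    [(u n + 1) / n]; the supremum of the former is therefore within [1 / n] of [u n / n]. *)
Lemma translation_number_exists :
  exists rho, forall n, (0 < n)%N -> `|u n - n%:R * rho| <= 1.
Proof.
pose S := [set r | exists2 n, (0 < n)%N & r = (u n - 1) / n%:R].
have ub n : (0 < n)%N -> ubound S ((u n + 1) / n%:R).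
  move=> n0 _ [m m0 ->].
  rewrite ler_pdivrMr ?ltr0n // mulrAC ler_pdivlMr ?ltr0n //.
  have [h1 _] := u_mul m n0; have [_ h2] := u_mul n m0.
  by rewrite mulnC in h2; lra.
have S0 : S !=set0 by exists ((u 1 - 1) / 1%:R); exists 1%N.
exists (sup S) => n n0; have n0' : 0 < n%:R :> R by rewrite ltr0n.
have h1 : (u n - 1) / n%:R <= sup S.
  by apply: ub_le_sup; [exists ((u 1 + 1) / 1%:R); exact: ub | exists n].
have h2 : sup S <= (u n + 1) / n%:R by apply: ge_sup => //; exact: ub.
rewrite ler_pdivrMr // in h1; rewrite ler_pdivlMr // in h2.
by rewrite ler_norml; lra.
Qed.

Lemma cvg_translation_number rho : (forall n, (0 < n)%N -> `|u n - n%:R * rho| <= 1) ->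
  (fun n => u n / n%:R) @ \oo --> rho.
Proof.
move=> h; apply/cvgrPdist_le => e e0; near=> n.
have n0 : (0 < n)%N by near: n; exists 1%N.
have n0' : 0 < n%:R :> R by rewrite ltr0n.
rewrite -[rho](mulfK (lt0r_neq0 n0')) -mulrBl normrM normfV (gtr0_norm n0').
rewrite distrC mulrC [rho * _]mulrC.
rewrite ler_pdivrMl // (le_trans (h n n0)) // -ler_pdivrMr // mul1r.
near: n; exact: nbhs_infty_ger.
Unshelve. all: by end_near. Qed.

(** The displacement [g] of [F^b + k] is continuous, periodic and never zero, so by the intermediate
    value theorem its minimum is positive or its maximum negative. Iteration turns this extremum
    into a bound of the same sign for [b rho + k]. *)
Lemma lift_with_translation_number rho :
  (forall n, (0 < n)%N -> `|u n - n%:R * rho| <= 1) -> lift_with_rotation F rho.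
Proof.
move=> h; split=> // a k x.
case: a => [|a]; first by rewrite /shifted_iter /= mul0r add0r ltrDl gtrDl.
set b := a.+1; pose g y := shifted_iter F b k y - y.
have g_cont : continuous g.
  move=> y; apply: cvgB; last exact: cvg_id.
  by apply: cvgD; [exact: iter_continuous | exact: cvg_cst].
have g_per y : g (y + 1) = g y.
  by rewrite /g /shifted_iter (_ : y + 1 = y + 1%:~R) // iterF_addz; ring.
have g_neq0 y : g y != 0.
  apply/eqP => e; have /eqP := aperiodic y (- k) (ltn0Sn a); apply.
  by move: e; rewrite rmorphN /g /shifted_iter -/b; lra.
have iter_g (c : R) n : (forall y, c <= g y) -> n%:R * (c - k%:~R) <= u (n * b).
  move=> hc; elim: n => [|n IH]; first by rewrite mul0r.
  rewrite mulSn /u iterD -/(u (n * b)).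
  by have := hc (u (n * b)); rewrite /g /shifted_iter -natr1; lra.
have iter_g' (c : R) n : (forall y, g y <= c) -> u (n * b) <= n%:R * (c - k%:~R).
  move=> hc; elim: n => [|n IH]; first by rewrite mul0r.
  rewrite mulSn /u iterD -/(u (n * b)).
  by have := hc (u (n * b)); rewrite /g /shifted_iter -natr1; lra.
(* The bounded error [1] disappears as [n] grows. *)
have arch (c t : R) : (forall n, (0 < n)%N -> n%:R * c <= n%:R * t + 1) -> c <= t.
  move=> hn; rewrite leNgt; apply/negP => tc.
  have ct : 0 < c - t by rewrite subr_gt0.
  have /andP[_ hm] := floor_itv (c - t)^-1.
  pose n := (Num.truncn (c - t)^-1).+1.
  have : (c - t)^-1 < n%:R by exact: truncnS_gt.
  by rewrite -(ltr_pM2r ct) mulVf ?lt0r_neq0 //; have := hn n isT; lra.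
have u_bound n : (0 < n)%N -> `|u (n * b) - n%:R * (b%:R * rho)| <= 1.
  by move=> n0; rewrite mulrA -natrM h // muln_gt0 n0.
have [z zmin] := periodic_min g_per g_cont.
have [|y|z' zmax] := @periodic_min R (fun y => - g y).
- by move=> y; rewrite g_per.
- by apply: cvgN; exact: g_cont.
have zmax' y : g y <= g z' by rewrite -lerN2.
have gE y : (y < shifted_iter F b k y) = (0 < g y) by rewrite subr_gt0.
have gE' y : (shifted_iter F b k y < y) = (g y < 0) by rewrite subr_lt0.
rewrite gE gE'.
have [gz|gz] := ltP 0 (g z).
  have rho_ge : g z <= b%:R * rho + k%:~R.
    apply: arch => n n0; have := iter_g _ n zmin; have := u_bound n n0.
    by rewrite ler_norml; lra.
  have gx := lt_le_trans gz (zmin x); have rx := lt_le_trans gz rho_ge.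
  by rewrite gx rx !ltNge !ltW.
have [gz'|gz'] := ltP (g z') 0.
  have rho_le : b%:R * rho + k%:~R <= g z'.
    apply: arch => n n0; have := iter_g' _ n zmax'; have := u_bound n n0.
    by rewrite ler_norml; lra.
  have gx := le_lt_trans (zmax' x) gz'; have rx := le_lt_trans rho_le gz'.
  by rewrite gx rx !ltNge !ltW.
exfalso; have [zz'|zz'] := leP z z'.
  have [||c _ /eqP] := @IVT R g z z' 0 zz'; last by apply/negP; exact: g_neq0.
    exact: continuous_subspaceT.
  by rewrite ge_min gz le_max gz' orbT.
have [||c _ /eqP] := @IVT R g z' z 0 (ltW zz'); last by apply/negP; exact: g_neq0.
  exact: continuous_subspaceT.
by rewrite ge_min gz orbT le_max gz'.
Qed.

End RotationNumber.

Section RotationIrrational.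
Context (R : realType).
Implicit Types (F : R -> R) (rho x : R) (a n : nat) (k : int).

(** If [a rho + k] vanished, the order clause would exclude displacement in either direction and
    [F^a + k] would have a fixed point. *)
Lemma lift_rotation_irrational F rho a k : lift_with_rotation F rho ->
  (forall x, iter a F x != x - k%:~R) -> a%:R * rho + k%:~R != 0.
Proof.
move=> [_ _ _ _ /(_ a k 0)[h1 h2]] /(_ 0); apply: contraNN => /eqP e.
move: h1 h2; rewrite e ltxx /shifted_iter => /negbT; rewrite -leNgt => h1 /negbT.
by rewrite -leNgt => h2; apply/eqP; lra.
Qed.

Lemma shift_lift_iter F rho k a x : lift_with_rotation F rho ->
  iter a (fun y => F y - k%:~R) x = iter a F x - (a%:R * k%:~R).
Proof.
move=> hF; elim: a => [|a IH] /=; first by rewrite mul0r subr0.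
have cast b : b%:R * k%:~R = (b%:Z * k)%:~R :> R by rewrite rmorphM.
by rewrite IH cast -rmorphN (lift_addz hF) rmorphN rmorphM -natr1 /=; ring.
Qed.

Lemma lift_with_rotation_shift F rho k : lift_with_rotation F rho ->
  lift_with_rotation (fun y => F y - k%:~R) (rho - k%:~R).
Proof.
move=> hF; have [mF pF cF sF rF] := hF; split.
- by move=> x y; rewrite lerD2r mF.
- by move=> x; rewrite pF addrAC.
- by move=> x; apply: cvgB; [exact: cF | exact: cvg_cst].
- by move=> y; have [x hx] := sF (y + k%:~R); exists x; rewrite hx addrK.
move=> a l x; have [h1 h2] := rF a (l - a%:Z * k) x.
have e : shifted_iter (fun y => F y - k%:~R) a l x =
    shifted_iter F a (l - a%:Z * k) x.
  by rewrite /shifted_iter (shift_lift_iter _ _ _ hF) rmorphB rmorphM /=; ring.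
have e' : a%:R * (rho - k%:~R) + l%:~R = a%:R * rho + (l - a%:Z * k)%:~R.
  by rewrite rmorphB rmorphM /=; ring.
by rewrite e e' h1 h2.
Qed.

End RotationIrrational.

(** * The circle *)

Section Circle.
Context (R : realType).
Implicit Types (x y a b : R) (k : int) (z : circle R).
Local Notation pi := (@circle_pi R).

Lemma circle_piP x y : pi x = pi y <-> exists k, x = y + k%:~R.
Proof.
have E : (x - y \in integers R) = (\pi_(Quotient.quot (integers R)) x ==
    \pi_(Quotient.quot (integers R)) y) by exact: Quotient.idealrBE.
have -> : pi x = pi y <-> x - y \in integers R.
  by rewrite E; split=> [xy|/eqP //]; apply/eqP.
split=> [xy|[k ->]]; last by rewrite addrC addKr; apply/intrP; exists k.
have /intrP[k hk] : x - y \is a Num.int by exact: xy.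
by exists k; rewrite -hk subrKC.
Qed.

Lemma circle_reprK z : pi (repr z) = z. Proof. exact: reprK. Qed.

Lemma circle_pi_continuous : continuous pi.
Proof. exact: pi_continuous. Qed.

Lemma circle_pi_intr x k : pi (x + k%:~R) = pi x.
Proof. by apply/circle_piP; exists k. Qed.

Lemma repr_circle_pi x : exists k, repr (pi x) = x + k%:~R.
Proof. by apply/circle_piP; rewrite circle_reprK. Qed.

Lemma fracpart_intr x k : fracpart (x + k%:~R) = fracpart x.
Proof.
by rewrite /fracpart floorDrz ?intr_int // intrKfloor rmorphD /=; ring.
Qed.

Lemma fracpart_id x : 0 <= x < 1 -> fracpart x = x.
Proof.
move=> /andP[x0 x1]; rewrite /fracpart (floor_def (m := 0)) ?subr0 //.
by rewrite x0 add0r.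
Qed.

Lemma ccw_pi a b : ccw (pi a) (pi b) = fracpart (b - a).
Proof.
rewrite /ccw; have [k ->] := repr_circle_pi a; have [l ->] := repr_circle_pi b.
rewrite -(fracpart_intr (b - a) (l - k)) rmorphB /=; congr fracpart; ring.
Qed.

Lemma fracpart_decomp x : exists2 k, x = fracpart x + k%:~R & 0 <= fracpart x < 1.
Proof.
exists (Num.floor x); first by rewrite /fracpart subrK.
by have /andP[h1 h2] := floor_itv x; rewrite rmorphD /= in h2; rewrite /fracpart; lra.
Qed.

Lemma ccw_arc_pi a b : a <= b < a + 1 -> ccw_arc (pi a) (pi b) = pi @` `[a, b].
Proof.
move=> /andP[ab ba]; have bE : ccw (pi a) (pi b) = b - a.
  by rewrite ccw_pi fracpart_id //; lra.
rewrite /ccw_arc bE; apply/seteqP; split=> z /=.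
  rewrite -(circle_reprK z) ccw_pi => h.
  have [k kE /andP[f0 f1]] := fracpart_decomp (repr z - a).
  exists (a + fracpart (repr z - a)); first by rewrite in_itv /=; lra.
  rewrite circle_reprK -[RHS]circle_reprK; apply/circle_piP; exists (- k).
  by rewrite rmorphN /=; lra.
move=> [x]; rewrite in_itv /= => /andP[ax xb] <-.
by rewrite ccw_pi fracpart_id; lra.
Qed.

Lemma ccw_arc_pi_notin a b x : a <= b < a + 1 -> b < x < a + 1 ->
  ~ ccw_arc (pi a) (pi b) (pi x).
Proof.
move=> /andP[ab ba] /andP[bx xa]; rewrite /ccw_arc /= !ccw_pi.
by rewrite !fracpart_id; lra.
Qed.

Lemma clength_pi a b : a <= b < a + 1 -> clength (pi @` `[a, b]) = (b - a)%:E.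
Proof.
have base a' b' : 0 <= a' < 1 -> a' <= b' < a' + 1 ->
    clength (pi @` `[a', b']) = (b' - a')%:E.
  move=> /andP[a0 a1] /andP[ab ba]; rewrite /clength.
  have [b1|b1] := ltP b' 1.
    have -> : `[0, 1[%classic `&` pi @^-1` (pi @` `[a', b']) = `[a', b']%classic.
      apply/seteqP; split=> x /=; rewrite !in_itv /=.
        move=> [/andP[x0 x1] [y]]; rewrite in_itv /= => /andP[ay yb] /circle_piP[k yx].
        have k0 : k = 0.
          have : (-1)%:~R < k%:~R :> R by lra.
          have : k%:~R < 1%:~R :> R by lra.
          by rewrite !ltr_int; lia.
        by rewrite k0 addr0 in yx; rewrite -yx ay.
      move=> /andP[ax xb]; split; first by lra.
      by exists x => //; rewrite in_itv /= ax.
    rewrite lebesgue_measure_itv /= lte_fin; case: ltP => // ba'.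
    by congr EFin; lra.
  (* When [b' >= 1] the arc passes the integer point, and its trace on [[0, 1[] has two pieces. *)
  have -> : `[0, 1[%classic `&` pi @^-1` (pi @` `[a', b']) =
      `[a', 1[%classic `|` `[0, b' - 1]%classic.
    apply/seteqP; split=> x /=; rewrite !in_itv /=.
      move=> [/andP[x0 x1] [y]]; rewrite in_itv /= => /andP[ay yb] /circle_piP[k yx].
      have : k = 0 \/ k = 1.
        have : (-1)%:~R < k%:~R :> R by lra.
        have : k%:~R < 2%:~R :> R by lra.
        by rewrite !ltr_int; lia.
      by case=> k0; rewrite k0 in yx; [left|right]; lra.
    case=> [/andP[ax x1]|/andP[x0 xb]]; split; try lra.
      by exists x => //; rewrite in_itv /=; lra.
    exists (x + 1); first by rewrite in_itv /=; lra.
    exact: (circle_pi_intr x 1).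
  have dis : `[a', 1[%classic `&` `[0, b' - 1]%classic = set0 :> set R.
    by apply/seteqP; split=> x //=; rewrite !in_itv /=; lra.
  have meas (i : interval R) : measurable [set` i] by exact: measurable_itv.
  have m1 : lebesgue_measure `[a', 1[%classic = (1 - a')%:E.
    by rewrite lebesgue_measure_itv /= lte_fin a1.
  have m2 : lebesgue_measure `[0, b' - 1]%classic = (b' - 1)%:E.
    rewrite lebesgue_measure_itv /= lte_fin; case: ltP => [b1'|b1'].
      by rewrite -EFinB subr0.
    by congr EFin; lra.
  apply: (eq_trans (measureU (@lebesgue_measure R) (meas _) (meas _) dis)).
  apply: (eq_trans (f_equal2 adde m1 m2)).
  by apply: (@eq_trans _ _ ((1 - a') + (b' - 1))%:E) => //; congr EFin; ring.
move=> /andP[ab ba]; have /andP[h1 h2] := floor_itv a; rewrite rmorphD /= in h2.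
pose k := Num.floor a; rewrite -/k in h1 h2.
have -> : pi @` `[a, b] = pi @` `[a - k%:~R, b - k%:~R].
  apply/seteqP; split=> z [x]; rewrite /= in_itv /= => xab <-.
    exists (x - k%:~R); first by rewrite in_itv /=; lra.
    by rewrite -rmorphN circle_pi_intr.
  exists (x + k%:~R); first by rewrite in_itv /=; lra.
  exact: circle_pi_intr.
by rewrite base; [congr EFin|..]; lra.
Qed.

End Circle.

(** * Lifts of circle maps to the line *)

Section Lifts.
Context (R : realType).
Implicit Types (f : circle R -> circle R) (F : R -> R) (x y : R) (k : int).
Local Notation pi := (@circle_pi R).

Lemma continuous_intr_cst (h : R -> R) : continuous h ->
  (forall x, exists k, h x = k%:~R) -> forall x y, h x = h y.
Proof.
move=> ch hk.
have main x y : x <= y -> h x = h y.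
  move=> xy; apply/eqP; apply: contraT => hxy.
  have [a ha] := hk x; have [b hb] := hk y.
  have ab : a != b by apply: contra hxy => /eqP e; rewrite ha hb e.
  (* A value halfway between consecutive integers, which an integer-valued function cannot take. *)
  pose v : R := (Num.min a b)%:~R + 2^-1.
  have minI : (Num.min a b)%:~R = Num.min (h x) (h y) :> R.
    by rewrite ha hb !minElt ltr_int; case: ifP.
  have maxI : (Num.max a b)%:~R = Num.max (h x) (h y) :> R.
    by rewrite ha hb !maxElt ltr_int; case: ifP.
  have [||c _ hc] := @IVT R h x y v xy; first exact: continuous_subspaceT.
    rewrite -minI -maxI /v lerDl invr_ge0 ler0n /=.
    have : (Num.min a b + 1)%:~R <= (Num.max a b)%:~R :> R by rewrite ler_int; lia.
    by rewrite rmorphD /=; lra.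
  have [d hd] := hk c; move: hc; rewrite hd /v => e.
  have e1 : (Num.min a b)%:~R < d%:~R :> R by lra.
  have e2 : d%:~R < (Num.min a b + 1)%:~R :> R by rewrite rmorphD /=; lra.
  by move: e1 e2; rewrite !ltr_int; lia.
by move=> x y; have [/main //|/ltW/main ->] := leP x y.
Qed.

Lemma lift_unique f F F' : is_lift f F -> is_lift f F' ->
  exists k, forall x, F' x = F x + k%:~R.
Proof.
move=> [cF hF] [cF' hF'].
have hk x : exists k, F' x - F x = k%:~R.
  have [k ->] : exists k, F' x = F x + k%:~R by apply/circle_piP; rewrite hF' hF.
  by exists k; rewrite addrC addKr.
have ch : continuous (fun x => F' x - F x).
  by move=> x; apply: cvgB; [exact: cF'|exact: cF].
have [k hk0] := hk 0; exists k => x.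
by rewrite -hk0 (continuous_intr_cst ch hk 0 x) subrKC.
Qed.

Lemma lift_ofP f F : is_lift f F -> is_lift f (lift_of f).
Proof.
by move=> hF; rewrite /lift_of; apply: (@getPex _ [set F | is_lift f F]); exists F.
Qed.

Lemma lift_iter f F a x : is_lift f F -> pi (iter a F x) = iter a f (pi x).
Proof. by move=> [_ hF]; elim: a => //= a <-; rewrite hF. Qed.

Lemma is_lift_iter f F a : is_lift f F -> is_lift (iter a f) (iter a F).
Proof.
move=> hF; split; first by apply: iter_continuous; case: hF.
by move=> x; exact: lift_iter.
Qed.

Lemma is_lift_shift f F k : is_lift f F -> is_lift f (fun x => F x - k%:~R).
Proof.
move=> [cF hF]; split=> [x|x]; first by apply: cvgB; [exact: cF | exact: cvg_cst].
by rewrite -rmorphN circle_pi_intr hF.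
Qed.

Lemma lift_mono f F F' : is_lift f F -> is_lift f F' ->
  {homo F : x y / x < y} -> {mono F' : x y / x < y}.
Proof.
move=> hF hF' mF; have [k E] := lift_unique hF hF'.
have mF' : {homo F' : x y / x < y} by move=> x y xy; rewrite !E ltrD2r mF.
exact: leW_mono (le_mono mF').
Qed.

(** [F (x + 1) - F x] is a constant positive integer [k]. If [k >= 2], then [F] takes the value
    [F 0 + 1] strictly inside [[0, 1]], against the injectivity of [f]. *)
Lemma lift_periodic f F : injective f -> is_lift f F -> {mono F : x y / x < y} ->
  forall x, F (x + 1) = F x + 1.
Proof.
move=> injf hF mF; have [cF piF] := hF.
have [|k E] := @lift_unique f F (fun x => F (x + 1)) hF.
  split=> [x|x].
    apply: (@continuous_comp _ _ _ (fun x => x + 1) F); last exact: cF.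
    by apply: cvgD; [exact: cvg_id | exact: cvg_cst].
  by rewrite piF (circle_pi_intr x 1).
have k0 : 0 < k.
  have : F 0 < F (0 + 1) by rewrite mF ltrDl.
  by rewrite E ltrDl ltr0z.
have [k1|k1] := eqVneq k 1; first by move=> x; rewrite E k1.
have k2 : 2%:~R <= k%:~R :> R by rewrite ler_int; lia.
have E0 : F 1 = F 0 + k%:~R by rewrite -E add0r.
have [||c c01 hc] := @IVT R F 0 1 (F 0 + 1) ler01; first exact: continuous_subspaceT.
  apply/andP; split; first by rewrite ge_min lerDl ler01.
  by rewrite le_max E0; apply/orP; right; lra.
have /injf : f (pi c) = f (pi 0) by rewrite -!piF hc (circle_pi_intr (F 0) 1).
move=> /circle_piP[l cl]; rewrite add0r in cl.
move: c01; rewrite in_itv /= cl -[0]/(0%:~R) -[1]/(1%:~R) !ler_int => /andP[l0 l1].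
case: l l0 l1 cl => // -[|[|n]] // _ _ cl.
  have c0 : c = 0 by rewrite cl.
  by exfalso; move: hc; rewrite c0; lra.
have c1 : c = 1 by rewrite cl.
by exfalso; move: hc; rewrite c1 E0; lra.
Qed.

Lemma lift_surjective F : continuous F -> (forall x, F (x + 1) = F x + 1) ->
  forall y, exists x, F x = y.
Proof.
move=> cF per y.
have perz := degree_one_addz per.
have /andP[h1 h2] := floor_itv (y - F 0).
have [|||c _ hc] := @IVT R F (0 + (Num.floor (y - F 0))%:~R)
    (0 + (Num.floor (y - F 0) + 1)%:~R) y; last by exists c.
- by rewrite !add0r ler_int; lia.
- exact: continuous_subspaceT.
- by rewrite !perz ge_min le_max; apply/andP; split; apply/orP; [left|right]; lra.
Qed.

End Lifts.

(** * Multicritical circle maps *)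

Section MulticriticalLift.
Context (R : realType).
Implicit Types (f : circle R -> circle R) (F : R -> R) (x y e : R) (k : int).
Local Notation pi := (@circle_pi R).

Lemma derive1_addc F (c : R) : (forall x, derivable F x 1) ->
  derive1 (fun x => F x + c) = derive1 F.
Proof.
move=> dF; apply/funext => x; rewrite !derive1E.
by rewrite (@derive_val _ _ _ _ _ _ _ (is_derive_addc c (derivableP (dF x)))).
Qed.

(** [class_Cr] speaks of some lift; the chosen one differs from it by a constant and so has the same
    derivatives. *)
Lemma lift_of_derivable (r : nat) f (n : nat) x : class_Cr r f -> (n < r)%N ->
  is_derive x 1 (derive1n n (lift_of f)) (derive1n n.+1 (lift_of f) x).
Proof.
move=> [F hF [dF _]] nr.
have [k E] := lift_unique hF (lift_ofP hF).
have LE : lift_of f = (fun x => F x + k%:~R) by apply/funext.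
have DE m : (0 < m <= r)%N -> derive1n m (lift_of f) = derive1n m F.
  move=> /andP[m0 mr]; rewrite LE -(prednK m0) !derive1Sn derive1_addc // => y.
  by have := dF 0%N; apply; apply: leq_trans mr.
suff d : derivable (derive1n n (lift_of f)) x 1.
  by rewrite /= derive1E; exact: derivableP.
case: n nr => [|n] nr; last by rewrite DE ?(ltnW nr) //; exact: dF.
have [d _] := is_derive_addc k%:~R (derivableP (dF 0%N nr x)).
by rewrite LE.
Qed.

Lemma cdist_pi x e : 0 < `|x - e| < 2^-1 -> cdist (pi x) (pi e) = `|x - e|.
Proof.
move=> /andP[xe0 xe]; rewrite /cdist !ccw_pi.
move: xe0; rewrite normr_gt0 subr_eq0 neq_lt => /orP[] h; move: xe.
  rewrite ltr0_norm ?subr_lt0 // => h'; rewrite [fracpart (e - x)]fracpart_id; last by lra.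
  rewrite -(fracpart_intr (x - e) 1) fracpart_id; last by rewrite /=; lra.
  by rewrite opprB; apply/min_idPl; rewrite /=; lra.
rewrite gtr0_norm ?subr_gt0 // => h'; rewrite [fracpart (x - e)]fracpart_id; last by lra.
rewrite -(fracpart_intr (e - x) 1) fracpart_id; last by rewrite /=; lra.
by apply/min_idPr; rewrite /=; lra.
Qed.

Context (r : nat) (r3 : (3 <= r)%N) (f : circle R -> circle R).
Context (hf : multicritical r f) (hper : no_periodic_points f).
Local Notation L := (lift_of f).

Let f_inj : injective f.
Proof. by have [[_ [g _ [fK _]]] _ _ _] := hf; exact: can_inj fK. Qed.

Let L_lift : is_lift f L.
Proof. by have [_ [F hF _] _ _] := hf; exact: lift_ofP hF. Qed.

Let L_lt : {mono L : x y / x < y}.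
Proof. by have [_ [F hF mF] _ _] := hf; exact: lift_mono hF L_lift mF. Qed.

Let L_per : forall x, L (x + 1) = L x + 1.
Proof. exact: lift_periodic f_inj L_lift L_lt. Qed.

Let dL (n : nat) x : (n < 3)%N -> is_derive x 1 (derive1n n L) (derive1n n.+1 L x).
Proof. by move=> n3; have [_ _ h _] := hf; apply: lift_of_derivable h (leq_trans n3 r3). Qed.

Let D_per (n : nat) : (n < 3)%N -> forall x, derive1n n.+1 L (x + 1) = derive1n n.+1 L x.
Proof.
elim: n => [|n IH] n3.
  exact: (@derive_periodic R L (derive1n 1 L) 1 L_per (fun x => @dL 0 x isT)).
apply: (@derive_periodic R (derive1n n.+1 L) (derive1n n.+2 L) 0) => x.
  by rewrite IH ?addr0 // ltnW.
exact: dL.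
Qed.

Lemma cderiv_pi (n : nat) x : (n < 3)%N -> cderiv n.+1 f (pi x) = derive1n n.+1 L x.
Proof.
move=> n3; rewrite /cderiv; have [k ->] := repr_circle_pi x.
exact: periodic_intr (D_per n3) _ _.
Qed.

Lemma critical_points_exist : exists cs : seq R,
  (forall x, derive1n 1 L x = 0 <-> exists2 e, e \in cs & exists k, x = e + k%:~R) /\
  exists w, 0 < w < 1 /\ forall e, e \in cs -> exists alpha beta s,
    nonflat_near (derive1n 1 L) (derive1n 2 L) (derive1n 3 L) e w alpha beta s.
Proof.
have [_ _ _ [N [c [W [[N0 cinj critc Wc] schw nonf _]]]]] := hf.
pose cs := [seq repr (c i) | i <- enum 'I_N].
exists cs; split.
  move=> x; rewrite -(@cderiv_pi 0) //; split.
    move=> /critc[i xi]; exists (repr (c i)); first by apply/mapP; exists i; rewrite ?mem_enum.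
    by apply/circle_piP; rewrite circle_reprK.
  move=> [e /mapP[i _ ->] /circle_piP xi]; apply/critc; exists i.
  by rewrite xi circle_reprK.
(* [K] is the inverse of a radius: a larger constant means a smaller neighbourhood, so
   [uniform_bound] yields a common radius. *)
have [||K K0 hK] := @uniform_bound R _ cs (fun e K => 0 < K /\ exists alpha beta s,
  nonflat_near (derive1n 1 L) (derive1n 2 L) (derive1n 3 L) e K^-1 alpha beta s).
- move=> e K K' KK' [K0 [alpha [beta [s [a0 b0 s1 h]]]]].
  have K'0 : 0 < K' by apply: lt_le_trans KK'.
  split=> //; exists alpha, beta, s; split=> // x /andP[x0 xK]; apply: h.
  by rewrite x0 (lt_le_trans xK) // lef_pV2.
- move=> e /mapP[i _ ei].
  have [Wo Wci] := Wc i; have [alpha [beta [s [a0 ab s1 law]]]] := nonf i.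
  have piE : pi e = c i by rewrite ei circle_reprK.
  have : nbhs e (pi @^-1` W i).
    by apply: circle_pi_continuous; rewrite piE; exact: open_nbhs_nbhs.
  move=> /nbhs_ballP[d /= d0 dW].
  (* The [2] keeps [x] within [1 / 2] of [e], where [cdist] is [|x - e|] and no other translate of
     [e] occurs; [d^-1] keeps [x] over [W i]. *)
  pose K := Num.max 2 d^-1.
  have K2 : 2 <= K by rewrite le_max lexx.
  have K0 : 0 < K by apply: lt_le_trans K2.
  exists K; split=> //; exists alpha, beta, s; split=> //; first exact: lt_trans ab.
  move=> x /andP[x0 xK].
  have x2 : `|x - e| < 2^-1 by rewrite (lt_le_trans xK) // lef_pV2 ?posrE.
  have xd : `|x - e| < d.
    by rewrite (lt_le_trans xK) // invf_ple // le_max lexx orbT.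
  have Wx : W i (pi x) by apply: dW; rewrite /ball /= distrC.
  have xc : pi x <> c i.
    rewrite -piE => /circle_piP[k xe].
    move: x0 x2; rewrite xe addrC addKr -intr_norm.
    rewrite -[0]/(0%:~R) ltr_int => k0 k2.
    have : (1%:~R : R) <= `|k|%:~R by rewrite ler_int; lia.
    by rewrite /=; lra.
  have := schw i _ Wx xc; have := law _ Wx xc.
  rewrite /schwarzian !cderiv_pi // -piE cdist_pi ?x0 // => -[h1 h2] h3.
  by split=> //; exact: ltW.
exists (Num.min K^-1 2^-1); split.
  apply/andP; split; first by rewrite lt_min !invr_gt0 K0 ltr0n.
  by rewrite gt_min; apply/orP; right; lra.
move=> e /hK[_ [alpha [beta [s [a0 b0 s1 h]]]]].
exists alpha, beta, s; split=> // x /andP[x0 xK]; apply: h.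
by rewrite x0 (lt_le_trans xK) // ge_min lexx.
Qed.

Lemma lift_aperiodic F x a k : is_lift f F -> (0 < a)%N -> iter a F x != x + k%:~R.
Proof.
move=> hF a0; apply/eqP => e; apply: (hper (z := pi x) a0).
by rewrite -(lift_iter _ _ hF) e circle_pi_intr.
Qed.

(** [F] is the chosen lift minus the integer part of its translation number, so that its translation
    number is [rotation_number f] itself and not only modulo [1]. *)
Lemma multicritical_lift : exists (F F1 : R -> R) (cs : seq R) (A : R),
  [/\ is_lift f F, lift_with_rotation F (rotation_number f),
      cratio_distortion F cs A,
      forall c, c \in cs -> exists alpha beta s, power_law F c alpha beta s &
      forall x, is_derive x 1 F (F1 x) /\
        (F1 x = 0 -> exists2 e, e \in cs & exists k, x = e + k%:~R)].
Proof.
have L_le : {mono L : x y / x <= y} by apply: le_mono => x y; rewrite L_lt.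
have [L_cont _] := L_lift.
have L_surj := lift_surjective L_cont L_per.
have aper x a k : (0 < a)%N -> iter a L x != x + k%:~R by exact: lift_aperiodic.
have [rho hrho] := translation_number_exists L_le L_per.
have hL := lift_with_translation_number L_le L_per L_cont L_surj aper hrho.
pose k := Num.floor rho; pose F x := L x - k%:~R.
have rhoE : rotation_number f = rho - k%:~R.
  by rewrite /rotation_number (cvg_lim _ (cvg_translation_number hrho)).
have [cs [critP [w [w01 nf]]]] := critical_points_exist.
have F_lt : {mono F : x y / x < y} by move=> x y; rewrite ltrD2r L_lt.
have F_per x : F (x + 1) = F x + 1 by rewrite /F L_per addrAC.
have dF x : is_derive x 1 F (derive1n 1 L x).
  exact: is_derive_subc (@dL 0 x isT).
have dF1 x : is_derive x 1 (derive1n 1 L) (derive1n 2 L x) by exact: (@dL 1 x isT).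
have dF2 x : is_derive x 1 (derive1n 2 L) (derive1n 3 L x) by exact: (@dL 2 x isT).
have [A hA] := smooth_cratio_distortion F_lt F_per dF dF1 dF2 critP w01 nf.
exists F, (derive1n 1 L), cs, A; split=> //.
- exact: is_lift_shift.
- by rewrite rhoE; exact: lift_with_rotation_shift.
- by move=> c; exact: (smooth_power_law F_lt F_per dF dF1 w01 nf).
- by move=> x; split=> // /critP.
Qed.

Lemma rotation_number_irrational a k : (0 < a)%N ->
  a%:R * rotation_number f + k%:~R != 0.
Proof.
move=> a0; have [F [_ [_ [_ [hF rot _ _ _]]]]] := multicritical_lift.
apply: (lift_rotation_irrational rot) => x.
by rewrite -rmorphN; exact: lift_aperiodic.
Qed.

Lemma rotation_number_itv : 0 < rotation_number f < 1.
Proof.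
have /andP[h0 h1] : 0 <= rotation_number f < 1 by exact: fracpart_itv.
rewrite h1 lt0r h0 !andbT.
by have := rotation_number_irrational 0 (ltn0Sn 0); rewrite mul1r addr0.
Qed.

End MulticriticalLift.

(** * Arcs of the circle and the dynamical intervals *)

Section Arcs.
Context (R : realType).
Implicit Types (f : circle R -> circle R) (F : R -> R) (x y z u : R) (k l : int) (a b : nat).
Local Notation pi := (@circle_pi R).

(** Endpoints are taken on the line and in either order, so that both parities of [n] are treated
    alike. *)
Definition arc x y : set (circle R) := pi @` [set z | between x y z].

Lemma arcC x y : arc x y = arc y x.
Proof. by congr (pi @` _); apply/seteqP; split=> z; rewrite /between /= orbC. Qed.

Lemma arc_itv x y : x <= y -> arc x y = pi @` `[x, y].
Proof.
move=> xy; congr (pi @` _); apply/seteqP; split=> z; rewrite /between /= in_itv /=.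
  by case/orP=> /andP[h1 h2]; lra.
by move=> ->.
Qed.

Lemma clength_arc x y : `|y - x| < 1 -> clength (arc x y) = `|y - x|%:E.
Proof.
wlog xy : x y / x <= y => [H|].
  by have [|/ltW yx] := leP x y; [exact: H | rewrite arcC distrC; exact: H].
rewrite arc_itv // ger0_norm ?subr_ge0 // => h; rewrite clength_pi // xy /=.
by lra.
Qed.

Lemma between_dist x y u v : between x y u -> between x y v -> `|v - u| <= `|y - x|.
Proof.
move=> hu hv; have [xy|xy] := leP 0 (y - x).
  rewrite [leRHS]ger0_norm // ler_norml.
  by case/orP: hu => /andP[h1 h2]; case/orP: hv => /andP[h3 h4]; lra.
rewrite [leRHS]ltr0_norm // ler_norml.
by case/orP: hu => /andP[h1 h2]; case/orP: hv => /andP[h3 h4]; lra.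
Qed.

Context (f : circle R -> circle R) (F : R -> R) (rho : R).
Context (fF : is_lift f F) (hF : lift_with_rotation F rho).
Local Notation mv := (shifted_iter F).

Lemma circle_pi_shifted a k x : pi (mv a k x) = iter a f (pi x).
Proof. by rewrite /mv circle_pi_intr (lift_iter _ _ fF). Qed.

Lemma image_arc a k x y : iter a f @` arc x y = arc (mv a k x) (mv a k y).
Proof.
have mvB u v w : between (mv a k u) (mv a k v) (mv a k w) = between u v w.
  by rewrite /between !(shifted_iter_mono hF).
apply/seteqP; split=> z /=.
  move=> [_ [w wxy <-] <-]; exists (mv a k w); last exact: circle_pi_shifted.
  by rewrite /= mvB.
move=> [w]; have [v <-] := shifted_iter_surj hF a k w.
rewrite /= mvB => vxy <-; exists (pi v); first by exists v.
by rewrite circle_pi_shifted.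
Qed.

Lemma between_shifted a k b l x :
  (0 <= a%:R * rho + k%:~R <= b%:R * rho + l%:~R) ||
  (b%:R * rho + l%:~R <= a%:R * rho + k%:~R <= 0) ->
  between x (mv b l x) (mv a k x).
Proof.
by rewrite /between -{1 8}[x](shifted_iter00 F) !(shifted_iter_le hF) mul0r add0r.
Qed.

Lemma shifted_dist_lt1 a k x : `|a%:R * rho + k%:~R| < 1 -> `|mv a k x - x| < 1.
Proof.
rewrite !ltr_norml => /andP[h1 h2].
have e1 : mv 0 1 x = x + 1 by [].
have e2 : mv 0 (-1) x = x - 1 by rewrite /mv /= rmorphN.
have : mv a k x < mv 0 1 x by rewrite (shifted_iter_lt hF) mul0r add0r.
have : mv 0 (-1) x < mv a k x by rewrite (shifted_iter_lt hF) mul0r add0r rmorphN.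
by rewrite e1 e2; lra.
Qed.

Lemma iter_derive (F1 : R -> R) a x : (forall y, is_derive y 1 F (F1 y)) ->
  is_derive x 1 (iter a F) (\prod_(j < a) F1 (iter j F x)).
Proof.
move=> dF; elim: a => [|a IH].
  by rewrite big_ord0; exact: is_derive_id.
rewrite big_ord_recr /= mulrC.
exact: (@is_derive1_comp _ F (iter a F)).
Qed.

(** By the chain rule the derivative of [F^a] is a product along the orbit, so one factor vanishes.
    The integer [k] comes from the chosen representative of [pi x]. *)
Lemma critical_iter (F1 : R -> R) a x : (forall y, is_derive y 1 F (F1 y)) ->
  critical_point (iter a f) (pi x) ->
  exists j k, (j < a)%N /\ F1 (iter j F (x + k%:~R)) = 0.
Proof.
move=> dF; rewrite /critical_point /cderiv.
have hl := is_lift_iter a fF; have [l lE] := lift_unique hl (lift_ofP hl).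
have -> : lift_of (iter a f) = (fun y => iter a F y + l%:~R) by apply/funext.
have dFa y := iter_derive a y dF.
have [k ->] := repr_circle_pi x.
rewrite /= derive1_addc => [|y]; last by have [] := dFa y.
rewrite derive1E (@derive_val _ _ _ _ _ _ _ (dFa _)) => /eqP/prodf_eq0[j _ /eqP h].
by exists j, k.
Qed.

End Arcs.

Section DynamicalArcs.
Context (R : realType) (r : nat) (r3 : (3 <= r)%N) (f : circle R -> circle R).
Context (hf : multicritical r f) (hper : no_periodic_points f).
Context (F : R -> R).
Context (fF : is_lift f F) (hF : lift_with_rotation F (rotation_number f)).
Local Notation pi := (@circle_pi R).
Local Notation rho := (rotation_number f).
Local Notation p n := (cf_num rho n).
Local Notation t n := ((cf_denom rho n)%:R * rho + (- (p n)%:Z)%:~R).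

Lemma cf_oriented n : oriented_returns rho (cf_denom rho n) (- (p n)%:Z)
  (cf_denom rho n.+1) (- (p n.+1)%:Z).
Proof.
apply: cf_oriented_returns; first exact: (rotation_number_itv r3 hf hper).
by move=> a k a0; exact: (rotation_number_irrational r3 hf hper).
Qed.

(** Consecutive pairs of returns have opposite orientations, which rules out two of the four cases;
    the signs of [t_n + t_{n+1}] and [t_{n+1} + t_{n+2}] then place [t_{n+2}] between [0] and
    [t_n]. *)
Lemma cf_theta_signs n : [/\ 0 < t n < 1, t n.+1 < 0 & 0 < t n.+2 < t n] \/
  [/\ -1 < t n < 0, 0 < t n.+1 & t n < t n.+2 < 0].
Proof.
have flip m : (cf_denom rho m)%:R * - rho + (- - (p m)%:Z)%:~R = - t m.
  by rewrite !rmorphN /=; ring.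
have [] := cf_oriented n; have [] := cf_oriented n.+1; rewrite /consecutive_returns /=;
  rewrite ?flip => -[_ h1 h2 h3 _] [_ h4 h5 h6 _].
- by exfalso; lra.
- by left; split=> //; lra.
- by right; split; lra.
- by exfalso; lra.
Qed.

(** As [k] runs from [0] to [a_{n+1}], the displacement [t_n + k t_{n+1}] moves monotonically from
    [t_n] to [t_{n+2}], which has the same sign. *)
Lemma cf_theta_between n (k : nat) : (k <= pquot f n.+1)%N ->
  (0 <= t n + k%:R * t n.+1 <= t n) || (t n <= t n + k%:R * t n.+1 <= 0).
Proof.
move=> ka.
have step : t n.+2 = (cf_coef rho n.+1)%:R * t n.+1 + t n.
  by have := cf_theta_step rho n; rewrite !rmorphN /= -!pmulrn; lra.
have ka' : k%:R <= (cf_coef rho n.+1)%:R :> R by rewrite ler_nat.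
have k0 : 0 <= k%:R :> R by [].
case: (cf_theta_signs n) => -[h1 h2 h3]; apply/orP; [left|right]; apply/andP.
  have : (cf_coef rho n.+1)%:R * t n.+1 <= k%:R * t n.+1 by rewrite ler_nM2r.
  have : k%:R * t n.+1 <= 0 by rewrite mulr_ge0_le0 // ltW.
  by split; lra.
have : k%:R * t n.+1 <= (cf_coef rho n.+1)%:R * t n.+1 by rewrite ler_pM2r.
have : 0 <= k%:R * t n.+1 by rewrite mulr_ge0 // ltW.
by split; lra.
Qed.

(** On the line the lift [G2] of [f^{q_{n+2}}(x)] lies between [x] and [G], and this decides the
    test in [Iint] for either direction of [G]. *)
Lemma Iint_arc n x : Iint f n (pi x) =
  arc x (shifted_iter F (cf_denom rho n) (- (p n)%:Z) x).
Proof.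
set G := shifted_iter F _ _ x.
set G2 := shifted_iter F (cf_denom rho n.+2) (- (p n.+2)%:Z) x.
have piG : iter (qden f n) f (pi x) = pi G by rewrite (circle_pi_shifted fF).
have piG2 : iter (qden f n.+2) f (pi x) = pi G2 by rewrite (circle_pi_shifted fF).
rewrite /Iint piG piG2.
have lt a k b l := shifted_iter_lt hF a k b l x.
have x0 : x = shifted_iter F 0 0 x by rewrite shifted_iter00.
have x1 : x + 1 = shifted_iter F 0 1 x by [].
have xm1 : x - 1 = shifted_iter F 0 (-1) x by rewrite /shifted_iter /= rmorphN.
case: (cf_theta_signs n) => -[/andP[h1 h2] h3 /andP[h4 h5]].
  have xG : x < G by rewrite {1}x0 lt mul0r add0r.
  have Gx : G < x + 1 by rewrite x1 lt mul0r add0r.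
  have xG2 : x < G2 by rewrite {1}x0 lt mul0r add0r.
  have G2G : G2 < G by rewrite lt.
  have xGx : x <= G < x + 1 by rewrite Gx ltW.
  rewrite ccw_arc_pi // arc_itv ?ltW //; case: ifPn => // /negP[].
  by apply/mem_set; exists G2; rewrite //= in_itv /= !ltW.
have xG : G < x by rewrite {1}x0 lt mul0r add0r.
have Gx : x - 1 < G by rewrite xm1 lt mul0r add0r rmorphN.
have xG2 : G2 < x by rewrite {1}x0 lt mul0r add0r.
have G2G : G < G2 by rewrite lt.
case: ifPn => [/set_mem|_]; last by rewrite arcC arc_itv ?ltW // ccw_arc_pi //; lra.
(* Here [G] is to the left of [x]: the positive arc from [x] ends at [G + 1], before it reaches
   [G2 + 1]. *)
rewrite -(circle_pi_intr G 1) -(circle_pi_intr G2 1) => h.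
by have := @ccw_arc_pi_notin R x (G + 1%:~R) (G2 + 1%:~R); case=> //=; lra.
Qed.

End DynamicalArcs.

Theorem lemma4p2 (R : realType) (r : nat) (hr : (3 <= r)%N)
    (f : circle R -> circle R)
    (hf : multicritical r f) (hper : no_periodic_points f) :
  exists K : R, 1 < K /\
    forall c0 : circle R, critical_point f c0 ->
    forall n k : nat, (k < pquot f n.+1)%N ->
      let J := iter (qden f n + k * qden f n.+1)%N f @` Iint f n.+1 c0 in
      (exists2 z, J z & critical_point (iter (qden f n.+1) f) z) ->
      (K^-1%:E * clength (Iint f n c0) <= clength J)%E /\
      (clength J <= K%:E * clength (Iint f n c0))%E.
Proof.
have [F [F1 [cs [A [fF rot hA law crit]]]]] := multicritical_lift hr hf hper.
have [K K0 hK] := hit_le rot hA law.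
(* The [K] of [hit_le] is only positive and gives one inequality; adding [1] makes the constant
   exceed [1], which covers the other. *)
exists (1 + K); split; first by rewrite ltrDl.
move=> c0 _ n k kn J; rewrite {}/J /qden.
rewrite -(circle_reprK c0); set x := repr c0.
have theta_lt1 m : 
    `|(cf_denom (rotation_number f) m)%:R * rotation_number f +
      (- (cf_num (rotation_number f) m)%:Z)%:~R| < 1.
  rewrite ltr_norml.
  by case: (cf_theta_signs hr hf hper m) => -[/andP[h1 h2] _ _]; apply/andP; lra.
have arcE := Iint_arc hr hf hper fF rot; rewrite !arcE.
set rho := rotation_number f in rot arcE theta_lt1 *.
set q := cf_denom rho n; set Q := cf_denom rho n.+1.
set p := (- (cf_num rho n)%:Z); set P := (- (cf_num rho n.+1)%:Z).
(* The lift of [f^{q_n + k q_{n+1}}(c_0)]; the interval [J] becomes the arc between [u] and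
   [H u]. *)
pose u := shifted_iter F (q + k * Q) (p + k%:Z * P) x.
have Hu : shifted_iter F (q + k * Q) (p + k%:Z * P) (shifted_iter F Q P x) =
    shifted_iter F Q P u.
  by rewrite /u !(shifted_iterD rot) addnC addrC.
rewrite (image_arc fF rot _ (p + k%:Z * P)) -/u Hu => -[_ [y uHy <-]].
case/(critical_iter fF (fun y => (crit y).1)) => j [l [jQ /(crit _).2[e ecs [k' jE]]]].
have yE : iter j F y = e + (k' - l)%:~R.
  by move: jE; rewrite (iter_lift_addz rot) rmorphB /=; lra.
have thetaE (a : nat) : (q + a * Q)%:R * rho + (p + a%:Z * P)%:~R =
    (q%:R * rho + p%:~R) + a%:R * (Q%:R * rho + P%:~R).
  by rewrite natrD natrM rmorphD rmorphM /= -!pmulrn; ring.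
have bu : between x (shifted_iter F q p x) u.
  apply: (between_shifted rot); rewrite thetaE.
  exact: (cf_theta_between hr hf hper (ltnW kn)).
(* [H u] has index [k + 1] in the same sequence of points, and [k < a_{n+1}] keeps it between [x]
   and [G x]; this gives the upper bound. *)
have bHu : between x (shifted_iter F q p x) (shifted_iter F Q P u).
  rewrite (shifted_iterD rot); apply: (between_shifted rot).
  have -> : (Q + (q + k * Q) = q + k.+1 * Q)%N by rewrite mulSn addnCA.
  have -> : P + (p + k%:Z * P) = p + k.+1%:Z * P by rewrite intS; ring.
  by rewrite thetaE; exact: (cf_theta_between hr hf hper kn).
have lower := hK _ _ _ _ _ _ _ _ _ _ _ _ (cf_oriented hr hf hper n)
  (cf_oriented hr hf hper n.+1) ecs jQ bu uHy yE.
have upper := between_dist bu bHu.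
rewrite (clength_arc (shifted_dist_lt1 rot x (theta_lt1 n))).
rewrite (clength_arc (shifted_dist_lt1 rot u (theta_lt1 n.+1))).
rewrite -!EFinM !lee_fin; split.
  rewrite ler_pdivrMl ?addr_gt0 // (le_trans lower) // ler_wpM2r //.
  by rewrite lerDr.
by rewrite (le_trans upper) // ler_peMl // lerDl ltW.
Qed.
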